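(* Let $X$ be a dendrite and let $f:X\to X$ be a continuous monotone map. For each $n\in\mathbb N$: (a) $\omega_{\mathcal F_n(f)}(A)$ is a minimal set of $\mathcal F_n(f)$ for each $A\in\mathcal F_n(X)$; (b) $\overline{\mathrm P(\mathcal F_n(f))}=\Lambda(\mathcal F_n(f))=\mathrm{RR}(\mathcal F_n(f))$.
   Context: A dendrite is a locally connected continuum (compact connected metric space) containing no simple closed curve. A map is monotone if the preimage of every connected set is connected. $\mathbb N$ denotes the positive integers. $2^X$ is the set of nonempty closed subsets of $X$ with the Hausdorff metric $d_H$, and $2^f:2^X\to2^X$, $2^f(A)=f(A)$. $\mathcal F_n(X)\subset 2^X$ is the family of nonempty subsets of $X$ with at most $n$ points, and $\mathcal F_n(f)=2^f|_{\mathcal F_n(X)}:\mathcal F_n(X)\to\mathcal F_n(X)$. For a continuous self-map $F$ of a compact metric space $(Y,\rho)$: $\omega_F(y)=\bigcap_{n\in\mathbb N}\overline{\{F^k(y):k\ge n\}}$; $\Lambda(F)=\bigcup_{y\in Y}\omega_F(y)$; $\mathrm P(F)$ is the set of periodic points; $\mathrm{RR}(F)$ is the set of regularly recurrent points, i.e. $y$ such that for every $\varepsilon>0$ there is $N\in\mathbb N$ with $\rho(y,F^{kN}(y))<\varepsilon$ for all $k\in\mathbb N$. A minimal set of $F$ is a nonempty closed $F$-invariant set ($F(M)\subset M$) that is minimal with respect to inclusion for these properties. *)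

(* Defs.v *)
From HB Require Import structures.
From mathcomp Require Import all_boot all_order all_algebra.
From mathcomp Require Import all_classical all_reals all_analysis.

Set Implicit Arguments.
Unset Strict Implicit.
Unset Printing Implicit Defensive.
Import Order.TTheory GRing.Theory Num.Theory.
Import numFieldNormedType.Exports.

Local Open Scope classical_set_scope.
Local Open Scope ring_scope.

Definition homeomorphic (T U : topologicalType) (A : set T) (B : set U) :=
  exists (h : T -> U) (g : U -> T),
    [/\ {within A, continuous h}, {within B, continuous g},
        h @` A = B, g @` B = A & forall x, A x -> g (h x) = x].

Definition unit_circle (R : realType) : set (R * R) :=
  [set z | z.1 ^+ 2 + z.2 ^+ 2 = 1].

Definition simple_closed_curve (R : realType) (X : metricType R) (S : set X) :=
  homeomorphic (@unit_circle R) S.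

Definition locally_connected (T : topologicalType) :=
  forall (x : T) (U : set T), nbhs x U ->
    exists V : set T, [/\ open V, connected V, V x & V `<=` U].

Definition dendrite (R : realType) (X : metricType R) :=
  [/\ compact [set: X], connected [set: X], locally_connected X &
      ~ exists S : set X, simple_closed_curve S].

Definition monotone_map (T U : topologicalType) (f : T -> U) :=
  forall C : set U, connected C -> connected (f @^-1` C).

Section HausdorffDistance.
Context {R : realType} {X : metricType R}.
Implicit Types A B C : set X.

Definition hausdorff_radii A B : set R :=
  [set e | [/\ 0 < e, A `<=` \bigcup_(b in B) ball b e
                    & B `<=` \bigcup_(a in A) ball a e]].

(* The infimum is taken in R, so this is meaningful only when the set of radii
   is nonempty, as it is for nonempty bounded A and B. *)
Definition hausdorff_dist A B : R := inf (hausdorff_radii A B).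

Lemma hausdorff_radiiC A B : hausdorff_radii A B = hausdorff_radii B A.
Proof. by apply/seteqP; split=> e [? ? ?]; split. Qed.

Lemma hausdorff_dist_has_lbound A B : has_lbound (hausdorff_radii A B).
Proof. by exists 0 => e [/ltW]. Qed.

Lemma hausdorff_radii_upward A B (d e : R) :
  hausdorff_radii A B d -> d <= e -> hausdorff_radii A B e.
Proof.
move=> [d0 AB BA] de; split; first exact: lt_le_trans de.
- by move=> x /AB[y By yx]; exists y => //; exact: le_ball yx.
- by move=> x /BA[y By yx]; exists y => //; exact: le_ball yx.
Qed.

Lemma hausdorff_radii_triangle A B C (d e : R) :
  hausdorff_radii A B d -> hausdorff_radii B C e ->
  hausdorff_radii A C (d + e).
Proof.
move=> [d0 AB BA] [e0 BC CB]; split; first exact: addr_gt0.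
- move=> x /AB[y /BC[z Cz zy] yx]; exists z => //.
  by rewrite addrC; exact: ball_triangle yx.
- move=> x /CB[y /BA[z Cz zy] yx]; exists z => //.
  exact: ball_triangle yx.
Qed.

Lemma finite_hausdorff_radii A B : finite_set A -> finite_set B ->
  A !=set0 -> B !=set0 -> hausdorff_radii A B !=set0.
Proof.
move=> fA fB [a0 Aa0] [b0 Bb0].
have bnd (C : set X) (c : X) : finite_set C ->
    exists2 r : R, 0 < r & forall x, C x -> mdist c x < r.
  move=> /finite_seqP[s ->]; exists (1 + \sum_(y <- s) mdist c y).
    by rewrite ltr_pwDl// sumr_ge0// => y _; exact: mdist_ge0.
  move=> x /= xs; rewrite ltr_pwDl//.
  rewrite (big_rem x xs)/= lerDl sumr_ge0// => y _; exact: mdist_ge0.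
have [r r0 hr] := bnd A b0 fA; have [q q0 hq] := bnd B a0 fB.
exists (r + q); split; first exact: addr_gt0.
- move=> x Ax; exists b0 => //; rewrite ballEmdist/=.
  by rewrite (lt_trans (hr x Ax))// ltrDl.
- move=> x Bx; exists a0 => //; rewrite ballEmdist/=.
  by rewrite (lt_trans (hq x Bx))// ltrDr.
Qed.

End HausdorffDistance.

(* The nonempty subsets of X with at most n points (A #<= `I_n). They are closed,
   see fhs_closed below, so this is a subspace of the hyperspace of nonempty
   closed subsets with the Hausdorff metric. For finite sets the metric axioms
   hold without compactness of X. *)
Record finite_hyperspace (R : realType) (X : metricType R) (n : nat) :=
  FiniteHyperspace {
    fhs_set :> set X;
    fhs_nonempty : fhs_set !=set0;
    fhs_card : (fhs_set #<= `I_n)%card }.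

Section FiniteHyperspaceMetric.
Context {R : realType} {X : metricType R} {n : nat}.
Implicit Types A B C : finite_hyperspace X n.

Lemma fhs_inj A B : A = B :> set X -> A = B.
Proof.
case: A B => [A A0 An] [B B0 Bn] /= AB; move: A0 An; rewrite AB => A0 An.
by congr FiniteHyperspace; exact: Prop_irrelevance.
Qed.

Lemma fhs_finite A : finite_set A.
Proof. exact: card_le_finite (fhs_card A) (finite_II n). Qed.

Lemma fhs_closed A : closed A.
Proof.
apply: (iffLR accessible_finite_set_closed) (fhs_finite A).
exact/hausdorff_accessible/metric_hausdorff.
Qed.

Lemma fhs_radii A B : hausdorff_radii A B !=set0.
Proof.
by apply: finite_hausdorff_radii;
  [exact: fhs_finite|exact: fhs_finite|exact: fhs_nonempty|exact: fhs_nonempty].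
Qed.

Definition fhs_dist A B : R := hausdorff_dist A B.

Lemma fhs_dist_ltP A B (e : R) :
  fhs_dist A B < e <-> exists2 d, d < e & hausdorff_radii A B d.
Proof.
split=> [|[d de dAB]].
  by case/(inf_lt (fhs_radii A B)) => d dAB de; exists d.
by apply: le_lt_trans de; exact: (ge_inf (hausdorff_dist_has_lbound A B) dAB).
Qed.

Lemma fhs_distC A B : fhs_dist A B = fhs_dist B A.
Proof. by rewrite /fhs_dist /hausdorff_dist hausdorff_radiiC. Qed.

Lemma fhs_dist_ge0 A B : 0 <= fhs_dist A B.
Proof. by apply: lb_le_inf; [exact: fhs_radii|move=> e [/ltW]]. Qed.

Lemma fhs_distxx A : fhs_dist A A = 0.
Proof.
apply/eqP; rewrite eq_le fhs_dist_ge0 andbT; apply/ler_addgt0Pl => e e0.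
rewrite addr0; apply: (ge_inf (hausdorff_dist_has_lbound A A)).
by split=> // x Ax; exists x => //; exact: ballxx.
Qed.

Lemma fhs_dist_eq0 A B : fhs_dist A B = 0 -> A = B.
Proof.
move=> AB0.
have rad (e : R) : 0 < e -> hausdorff_radii A B e.
  rewrite -AB0 => /fhs_dist_ltP[d /ltW de dAB].
  exact: hausdorff_radii_upward dAB de.
apply/fhs_inj/seteqP; split=> x xA.
- apply: fhs_closed => U /nbhs_ballP[e /= e0 eU].
  have [_ /(_ _ xA)[y By yx] _] := rad e e0.
  by exists y; split=> //; apply: eU; exact: ball_sym.
- apply: fhs_closed => U /nbhs_ballP[e /= e0 eU].
  have [_ _ /(_ _ xA)[y By yx]] := rad e e0.
  by exists y; split=> //; apply: eU; exact: ball_sym.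
Qed.

Lemma fhs_dist_triangle B A C : fhs_dist A C <= fhs_dist A B + fhs_dist B C.
Proof.
apply/ler_addgt0Pr => e e0; apply: ltW.
have e2 : 0 < e / 2 by rewrite divr_gt0.
have /fhs_dist_ltP[d1 d1e h1] : fhs_dist A B < fhs_dist A B + e / 2.
  by rewrite ltrDl.
have /fhs_dist_ltP[d2 d2e h2] : fhs_dist B C < fhs_dist B C + e / 2.
  by rewrite ltrDl.
apply/fhs_dist_ltP; exists (d1 + d2); last exact: hausdorff_radii_triangle h1 h2.
by rewrite (splitr e) addrACA; exact: ltrD.
Qed.

End FiniteHyperspaceMetric.

HB.instance Definition _ (R : realType) (X : metricType R) (n : nat) :=
  gen_eqMixin (finite_hyperspace X n).
HB.instance Definition _ (R : realType) (X : metricType R) (n : nat) :=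
  gen_choiceMixin (finite_hyperspace X n).
HB.instance Definition _ (R : realType) (X : metricType R) (n : nat) :=
  isMetric.Build R (finite_hyperspace X n) (@fhs_distxx R X n)
    (@fhs_dist_eq0 R X n) (@fhs_distC R X n) (@fhs_dist_triangle R X n).

Section InducedMap.
Context {R : realType} {X : metricType R} (f : X -> X) (n : nat).

Lemma fhs_map_nonempty (A : finite_hyperspace X n) : f @` A !=set0.
Proof. by have [x Ax] := fhs_nonempty A; exists (f x), x. Qed.

Lemma fhs_map_card (A : finite_hyperspace X n) : (f @` A #<= `I_n)%card.
Proof. exact: card_le_trans (card_image_le f A) (fhs_card A). Qed.

Definition fhs_map (A : finite_hyperspace X n) : finite_hyperspace X n :=
  FiniteHyperspace (fhs_map_nonempty A) (fhs_map_card A).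

End InducedMap.
Arguments fhs_map {R X} f n A.

Section Dynamics.
Context {R : realType} {Y : metricType R} (F : Y -> Y).

Definition omega_limit (y : Y) : set Y :=
  \bigcap_(m in [set m | (0 < m)%N])
    closure [set iter k F y | k in [set k | (m <= k)%N]].

Definition Lambda : set Y := \bigcup_(y in [set: Y]) omega_limit y.

Definition periodic_points : set Y :=
  [set y | exists2 p, (0 < p)%N & iter p F y = y].

Definition regularly_recurrent : set Y :=
  [set y | forall e : R, 0 < e -> exists2 N, (0 < N)%N &
     forall k, (0 < k)%N -> mdist y (iter (k * N) F y) < e].

Definition closed_invariant (M : set Y) :=
  [/\ M !=set0, closed M & F @` M `<=` M].

Definition minimal_set (M : set Y) :=
  closed_invariant M /\
  forall M' : set Y, closed_invariant M' -> M' `<=` M -> M' = M.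

End Dynamics.

(* Main.v *)
(* A point p lies on the arc [x,y] of a dendrite iff every connected set
   containing x and y contains p.  This relation makes sense in every locally
   connected continuum, and monotone maps preserve it.  The absence of simple
   closed curves is needed only for one consequence: any two points are
   separated by a third one.  Indeed, let h be an arc from u to v.  If its
   midpoint does not separate u from v, some path from u to v avoids it, and a
   piece of that path closes up a piece of the arc to a simple closed curve.

   Let x_i = f^i(x).  The key fact is that for every e there is N such that
   x_i and x_j are e-close whenever i = j mod N and i, j are large.  If c is
   periodic and x is not asymptotic to a periodic orbit, separation by c
   persists forward in time, so the times at which the orbit visits a given
   component of X \ {c} form residue classes: c does not separate x_i from x_j
   when i = j mod M(c).  If the key fact fails, there are u <> v such that for
   every M some residue class of times mod M visits every neighbourhood of u and
   of v infinitely often.  Take a fixed point a and a point w between u and v,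
   say on [a,u] but not on [a,v].  No image of w is periodic, and w cannot move
   away from a; comparing two returns near u shows that w moves towards a under
   some power f^S, hence converges to a periodic point q, which must then be a
   cluster point of the orbit of x.  The same analysis with v replaced by q is
   contradictory.

   The key fact passes to finite sets of points.  It implies that omega-limit
   sets are minimal and consist of regularly recurrent points, and, by the
   fixed point property applied to small invariant convex sets, that orbits are
   eventually close to periodic points. *)
Require Import Defs.
From mathcomp Require Import all_boot all_order all_algebra.
From mathcomp Require Import all_classical all_reals all_analysis.
From mathcomp Require Import ring lra zify.
Set Implicit Arguments.
Unset Strict Implicit.
Unset Printing Implicit Defensive.
Import Order.TTheory GRing.Theory Num.Theory.
Import numFieldNormedType.Exports.
Local Open Scope classical_set_scope.
Local Open Scope ring_scope.

(** * Betweenness in locally connected spaces *)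

(* In a dendrite, [btw x p y] means that p lies on the arc from x to y. *)
Definition btw (T : topologicalType) (x p y : T) :=
  forall C : set T, connected C -> C x -> C y -> C p.

Section Betweenness.
Context {T : topologicalType}.
Implicit Types x y z p q : T.

Lemma btwC x p y : btw x p y -> btw y p x.
Proof. by move=> h C cC Cy Cx; exact: (h C). Qed.

Lemma btwxx x p : btw x p x -> p = x.
Proof. by move=> /(_ [set x] (@connected1 _ x)); exact. Qed.

Lemma btw_transl x p y q : btw x p y -> btw x q p -> btw x q y.
Proof. by move=> h1 h2 C cC Cx Cy; apply: (h2 C) => //; exact: (h1 C). Qed.

(** If a connected [C] joins x to y without p, its union with any connected set joining y to z
    contains p, so p lies in the latter. *)
Lemma btw_split y x p z : btw x p z -> btw x p y \/ btw y p z.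
Proof.
move=> h; have [|] := pselect (btw x p y); first by left.
move=> /existsNP[C /not_implyP[cC /not_implyP[Cx /not_implyP[Cy Cp]]]]; right.
move=> D cD Dy Dz.
have : (C `|` D) p by apply: (h (C `|` D)); [apply: connectedU => //; exists y|left|right].
by case.
Qed.

Lemma btw_monotone (f : T -> T) x p y :
  monotone_map f -> btw x p y -> btw (f x) (f p) (f y).
Proof. by move=> mf h C /mf cC Cx Cy; exact: (h (f @^-1` C)). Qed.

Lemma monotone_iter (f : T -> T) n : monotone_map f -> monotone_map (iter n f).
Proof.
move=> mf; elim: n => [|n IHn] C cC; first by [].
have -> : iter n.+1 f @^-1` C = iter n f @^-1` (f @^-1` C) by [].
exact/IHn/mf.
Qed.

End Betweenness.

Lemma open_connected_component (T : topologicalType) (U : set T) x :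
  locally_connected T -> open U -> open (connected_component U x).
Proof.
move=> lcT oU; rewrite openE => y Cy.
have Uy : U y by exact: connected_component_sub Cy.
have [V [oV cV Vy VU]] := lcT y U (open_nbhs_nbhs (conj oU Uy)).
apply: (filterS _ (open_nbhs_nbhs (conj oV Vy))) => z Vz; apply: (connected_component_trans Cy).
by exists V.
Qed.

Section LocallyConnected.
Context {R : realType} {X : metricType R}.
Context (lcX : locally_connected X) (cX : connected [set: X]).
Implicit Types x y z p q : X.

Lemma nbhs_neq x p : p != x -> nbhs x (~` [set p]).
Proof.
move=> px; apply: open_nbhs_nbhs; split; last by apply/eqP; rewrite eq_sym.
by apply: closed_openC; apply: accessible_closed_set1;
  exact/hausdorff_accessible/metric_hausdorff.
Qed.

Lemma nbhs_connected_closure x p : p != x ->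
  exists V : set X, [/\ open V, connected V, V x & ~ closure V p].
Proof.
move=> px; have d0 : 0 < mdist x p / 2 by rewrite divr_gt0// mdist_gt0 eq_sym.
have [V [oV cV Vx VU]] := lcX (nbhsx_ballx x (mdist x p / 2) d0).
exists V; split => // /(_ _ (nbhsx_ballx p _ d0))[z [/VU]].
rewrite !ballEmdist/= => zx zp.
have := metric_triangle x z p; rewrite (metric_sym z p); lra.
Qed.

(** The component [C] of x in the complement of p has closure [C] together with p, since it would
    otherwise be clopen. If q differs from p, this closure forces q into [C], which then joins x to
    q without p. *)
Lemma btw_anti x p q : btw x p q -> btw x q p -> p = q.
Proof.
move=> xpq xqp; apply: contrapT => /eqP pq.
have [xp|xp] := eqVneq x p; first by subst p; move/btwxx: xqp => qx; rewrite qx eqxx in pq.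
set C := connected_component (~` [set p]) x.
have Cx : C x by apply: connected_component_refl; exact/eqP.
have cC : connected C by exact: component_connected.
have opC : open (~` [set p]).
  by apply: closed_openC; apply: accessible_closed_set1;
     exact/hausdorff_accessible/metric_hausdorff.
have oC : open C by exact: open_connected_component.
have clC : closure C `<=` C `|` [set p].
  move=> y Cy; have [->|yp] := eqVneq y p; [by right|left].
  have [V [oV cV Vy Vp]] := lcX (nbhs_neq (p := p) (x := y) ltac:(by rewrite eq_sym)).
  have [z [Cz Vz]] := Cy V (open_nbhs_nbhs (conj oV Vy)).
  by apply: (connected_component_trans Cz); exists V.
have [Cp|Cp] := pselect (closure C p); last first.
  have CT : C = setT.
    apply: cX; [by exists x|by exists C; rewrite ?setTI|].
    exists (closure C); rewrite ?setTI; first exact: closed_closure.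
    apply/seteqP; split; first exact: subset_closure.
    by move=> y yC; have [//|yp] := clC y yC; rewrite yp in yC.
  by apply: Cp; apply: subset_closure; rewrite CT.
have : closure C q.
  by apply: (xqp (closure C)) => //; [exact: connected_closure|exact: subset_closure].
move=> /clC[Cq|qp]; last by rewrite qp eqxx in pq.
by have /connected_component_sub := xpq _ cC Cx Cq; apply.
Qed.

Lemma btw_total x p q y : btw x p y -> btw x q y -> btw x p q \/ btw x q p.
Proof.
move=> xpy xqy.
have [|qpy] := btw_split q xpy; first by left.
have [|pqy] := btw_split p xqy; first by right.
by rewrite (btw_anti (btwC qpy) (btwC pqy)); left.
Qed.

Lemma btw_between x p q y : btw x q y -> btw x p q -> btw p q y.
Proof.
move=> xqy xpq; have [xqp|//] := btw_split p xqy.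
by rewrite (btw_anti xpq xqp).
Qed.

Lemma btw_chain x p y q : btw x p y -> btw p q y -> p != q -> btw x p q.
Proof.
move=> xpy pqy pq; have [//|qpy] := btw_split q xpy.
by rewrite (btw_anti (btwC qpy) (btwC pqy)) eqxx in pq.
Qed.

Lemma btw_transr x p y q : btw x p y -> btw p q y -> btw x q y.
Proof. by move=> h1 h2 C cC Cx Cy; apply: (h2 C) => //; exact: (h1 C). Qed.

Lemma btw_open x c y : btw x c y -> c != x -> \forall x' \near x, btw x' c y.
Proof.
move=> xcy cx; have [V [oV cV Vx VU]] := lcX (nbhs_neq cx).
have : nbhs x V by exact: open_nbhs_nbhs.
apply: filterS => x' Vx'.
have [/(_ V cV Vx Vx')/VU/(_ erefl)//|] := btw_split x' xcy; exact.
Qed.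

Lemma btw_open2 x c y : btw x c y -> c != x -> c != y ->
  exists A B : set X, [/\ nbhs x A, nbhs y B &
    forall x' y', A x' -> B y' -> btw x' c y'].
Proof.
move=> xcy cx cy; have [V [oV cV Vx VU]] := lcX (nbhs_neq cx).
have [W [oW cW Wy WU]] := lcX (nbhs_neq cy).
exists V, W; split; [exact: open_nbhs_nbhs|exact: open_nbhs_nbhs|].
move=> x' y' Vx' Wy'.
have [/(_ V cV Vx Vx')/VU/(_ erefl)//|x'cy] := btw_split x' xcy.
by have [//|/(_ W cW Wy' Wy)/WU/(_ erefl)] := btw_split y' x'cy.
Qed.

(** The points of a connected [D] avoiding p that are reached from x by open connected sets whose
    closures avoid p form a nonempty clopen subset of [D]. *)
Lemma nbtw_connected x p y : ~ btw x p y ->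
  exists E : set X, [/\ open E, connected E, E x, E y & ~ closure E p].
Proof.
move=> /existsNP[D /not_implyP[cD /not_implyP[Dx /not_implyP[Dy Dp]]]].
pose P (E : set X) := [/\ open E, connected E, E x & ~ closure E p].
pose Q : set X := \bigcup_(E in P) E.
suff : (D `&` Q) = D.
  by move=> /seteqP[_ /(_ y Dy)[_ [E [oE cE Ex Ep] Ey]]]; exists E.
have xp : p != x by apply/eqP => px; rewrite px in Dp.
have [V [oV cV Vx Vp]] := nbhs_connected_closure xp.
apply: cD.
- by exists x; split=> //; exists V.
- by exists Q => //; apply: bigcup_open => E [].
- exists (closure Q); first exact: closed_closure.
  apply/seteqP; split=> [z [Dz Qz]|z [Dz Qz]].
    by split=> //; exact: subset_closure.
  split=> //; have zp : p != z by apply/eqP => pz; rewrite pz in Dp.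
  have [W [oW cW Wz Wp]] := nbhs_connected_closure zp.
  have [t [[E [oE cE Ex Ep] Et] Wt]] := Qz W (open_nbhs_nbhs (conj oW Wz)).
  exists (E `|` W); last by right.
  split; [exact: openU|by apply: connectedU => //; exists t|by left|].
  by rewrite closureU => -[].
Qed.

Lemma nbtw_open x p y : ~ btw x p y ->
  exists2 E : set X, open E & [/\ E x, E y & nbhs p (fun p' =>
    forall x' y', E x' -> E y' -> ~ btw x' p' y')].
Proof.
move=> /nbtw_connected[E [oE cE Ex Ey Ep]]; exists E => //; split => //.
have : nbhs p (~` closure E).
  apply: open_nbhs_nbhs; split => //; exact/closed_openC/closed_closure.
by apply: filterS => p' p'E x' y' Ex' Ey' /(_ E cE Ex' Ey')/subset_closure.
Qed.

Lemma btw_closed_mid x y : closed [set p | btw x p y].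
Proof.
move=> p pc; apply: contrapT => /nbtw_open[E oE [Ex Ey]] /pc[q [xqy]].
by move=> /(_ x y Ex Ey); exact.
Qed.

Lemma btw_closed_end x p : closed [set y | btw x p y].
Proof.
move=> y yc; apply: contrapT => /nbtw_open[E oE [Ex Ey]].
have [z [xpz Ez] /nbhs_singleton/(_ x z Ex Ez)] := yc E (open_nbhs_nbhs (conj oE Ey)).
exact.
Qed.

Lemma nbtw_near x p y : ~ btw x p y -> \forall y' \near y, ~ btw x p y'.
Proof.
move=> /nbtw_open[E oE [Ex Ey] /nbhs_singleton h].
have : nbhs y E by exact: open_nbhs_nbhs.
by apply: filterS => y' Ey'; exact: h.
Qed.

Lemma btw_cvg (x p y : nat -> X) x' p' y' (F : set_system nat) : ProperFilter F ->
  x @ F --> x' -> p @ F --> p' -> y @ F --> y' ->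
  (\forall n \near F, btw (x n) (p n) (y n)) -> btw x' p' y'.
Proof.
move=> PF xx pp yy H; apply: contrapT => /nbtw_open[E oE [Ex Ey] h].
have h0 : F (x @^-1` E) by apply: xx; exact: open_nbhs_nbhs.
have h1 : F (p @^-1` (fun p' => forall x' y', E x' -> E y' -> ~ btw x' p' y')).
  exact: pp.
have h2 : F (y @^-1` E) by apply: yy; exact: open_nbhs_nbhs.
have [n [Hn [h0n [h1n h2n]]]] := filter_ex (filterI H (filterI h0 (filterI h1 h2))).
exact: (h1n _ _ h0n h2n Hn).
Qed.

End LocallyConnected.

(** * Compactness and limits along an ultrafilter *)

(** Zorn's lemma: the upper sets of a chain generate a filter on [K], and a cluster point of it
    bounds the chain because upper sets are closed. *)
Lemma compact_maximal (T : topologicalType) (K : set T) (le : T -> T -> Prop) :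
  compact K -> K !=set0 -> (forall x, le x x) ->
  (forall x y z, le x y -> le y z -> le x z) ->
  (forall x, closed [set y | le x y]) ->
  exists2 m, K m & forall r, K r -> le m r -> le r m.
Proof.
move=> cK [k0 Kk0] lexx le_trans lecl.
pose S := {x : T | K x}.
pose leS (s t : S) := `[< le (sval s) (sval t) >].
have [|||[m Km] mmax] := @ZL_preorder S (exist _ k0 Kk0) leS.
- by move=> s; exact/asboolP.
- by move=> r s t /asboolP rs /asboolP st; exact/asboolP/(le_trans _ _ _ rs st).
- move=> A Atot; have [[s0 As0]|A0] := pselect (exists s, A s); last first.
    by exists (exist _ k0 Kk0) => s As; exfalso; apply: A0; exists s.
  pose F := filter_from A (fun s => [set y | K y /\ le (sval s) y]).
  have FF : ProperFilter F.
    apply: filter_from_proper; last first.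
      by move=> s As; exists (sval s); split=> //; exact: svalP.
    apply: filter_from_filter; first by exists s0.
    move=> s t As At; have [/asboolP st|/asboolP ts] := Atot s t As At.
      by exists t => // y [Ky ty]; split; split=> //; exact: le_trans ty.
    by exists s => // y [Ky sy]; split; split=> //; exact: le_trans sy.
  have [|y [Ky clFy]] := cK F FF; first by exists s0 => // y [].
  exists (exist _ y Ky) => s As; apply/asboolP; apply: lecl => B yB.
  have [z [[Kz sz] Bz]] : (fun y => K y /\ le (sval s) y) `&` B !=set0.
    by apply: clFy => //; exists s.
  by exists z.
exists m => // r Kr mr; have /asboolP := mmax (exist _ r Kr) ltac:(exact/asboolP).
by [].
Qed.

(** A free ultrafilter on nat. Limits along it exist for all sequences of a compact space at once,
    so no subsequences have to be extracted. *)
Definition nat_ultra : set_system nat := projT1 (cid (ultraFilterLemma eventually_filter)).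

Lemma nat_ultra_proof : UltraFilter nat_ultra /\ \oo `<=` nat_ultra.
Proof. by rewrite /nat_ultra; case: cid. Qed.

#[global] Instance nat_ultra_ultra : UltraFilter nat_ultra.
Proof. by have [] := nat_ultra_proof. Qed.

Lemma nat_ultra_near (P : set nat) : (\forall n \near \oo, P n) -> nat_ultra P.
Proof. by have [_ /(_ P)] := nat_ultra_proof. Qed.

Lemma nat_ultra_ex (P : set nat) K : nat_ultra P -> exists2 n, (K <= n)%N & P n.
Proof.
move=> UP; have UK : nat_ultra [set n | (K <= n)%N].
  by apply: nat_ultra_near; exists K.
by have [n [Pn Kn]] := filter_ex (filterI UP UK); exists n.
Qed.

Lemma cvg_preimage (S : Type) (T : topologicalType) (F : set_system S) (g : S -> T)
  (z : T) A : g @ F --> z -> nbhs z A -> F (g @^-1` A).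
Proof. exact. Qed.

Lemma nat_ultra_cvg (T : topologicalType) (y : nat -> T) : compact [set: T] ->
  exists z : T, y @ nat_ultra --> z.
Proof.
move=> /(_ (y @ nat_ultra) _)[|z [_ clz]]; first exact: filterT.
exists z => B zB; have [//|UB] := in_ultra_setVsetC (y @^-1` B) nat_ultra_ultra.
have UyB : nat_ultra (y @^-1` (y @` (~` (y @^-1` B)))).
  by apply: filterS UB => n nB; exists n.
by have [_ [[n nB <-]]] := clz _ _ UyB zB.
Qed.

Lemma pigeonhole_mod (P : nat -> Prop) (phi : nat -> nat) M : (0 < M)%N ->
  (forall K, exists2 n, (K <= n)%N & P n) ->
  exists rho, forall K, exists n, [/\ (K <= n)%N, P n & (phi n %% M)%N = rho].
Proof.
move=> M0 PK; apply: contrapT => /forallNP h.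
have /choice[K_ K_P] (rho : nat) : exists K, forall n, (K <= n)%N -> P n ->
    (phi n %% M)%N <> rho.
  by have /existsNP[K /forallNP hK] := h rho; exists K => n Kn Pn e; exact: (hK n).
have [n nK Pn] := PK (\max_(r < M) K_ r).
have rM : (phi n %% M < M)%N by rewrite ltn_mod.
apply: (K_P (phi n %% M)%N n) => //; apply: leq_trans nK.
exact: (leq_bigmax (Ordinal rM)).
Qed.

Lemma near_all_lt (T : Type) (F : set_system T) (P : nat -> set T) N : Filter F ->
  (forall t, F (P t)) -> F (fun z => forall t, (t < N)%N -> P t z).
Proof.
move=> FF FP; elim: N => [|N IHN]; first exact: filterS filterT.
apply: filterS (filterI IHN (FP N)) => z [h hN] t.
by rewrite ltnS leq_eqVlt => /predU1P[->|/h].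
Qed.

(** The key fact for the orbit of one point. It is stated for an arbitrary metric space since it is
    also used for the induced map on finite sets. *)
Definition eventually_almost_periodic (R : realType) (Y : metricType R)
    (F : Y -> Y) (y : Y) :=
  forall e : R, 0 < e -> exists N K, (0 < N)%N /\ forall i j, (K <= i)%N -> (K <= j)%N ->
    i = j %[mod N] -> mdist (iter i F y) (iter j F y) < e.

Section Frequently.
Context {R : realType} {X : metricType R}.
Implicit Types (y : nat -> X) (z c : X).

Lemma not_cvg_cluster y c : compact [set: X] -> ~ (y @ \oo --> c) ->
  exists2 z, z != c & forall B, nbhs z B -> forall K, exists2 n, (K <= n)%N & B (y n).
Proof.
move=> cX /cvg_ballP/existsNP[e /not_implyP[e0 ye]].
have /choice[phi phiP] (K : nat) : exists n, (K <= n)%N /\ e <= mdist c (y n).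
  apply: contrapT => /forallNP h; apply: ye; exists K => // n /= Kn.
  by rewrite ballEmdist/= ltNge; apply/negP => ?; exact: (h n).
have [z yz] := nat_ultra_cvg (y \o phi) cX; exists z.
  apply/eqP => zc; have := yz _ (nbhsx_ballx z e e0).
  move=> /(nat_ultra_ex 0)[n _]; rewrite /= ballEmdist/= zc.
  by have [_] := phiP n; rewrite ltNge => ->.
move=> B /yz UB K; have [n Kn Bn] := nat_ultra_ex K UB.
by exists (phi n) => //; apply: leq_trans Kn _; have [] := phiP n.
Qed.

End Frequently.

Lemma uniformly_locally_connected (R : realType) (X : metricType R) :
  compact [set: X] -> locally_connected X ->
  forall e : R, 0 < e -> exists2 d, 0 < d & forall p q : X, mdist p q < d ->
    exists C, [/\ connected C, C p, C q & C `<=` ball p e].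
Proof.
move=> cX lcX e e0; apply: contrapT => h.
have /choice[pq pqP] (n : nat) : exists pq : X * X, mdist pq.1 pq.2 < n.+1%:R^-1 /\
    ~ exists C, [/\ connected C, C pq.1, C pq.2 & C `<=` ball pq.1 e].
  apply: contrapT => /forallNP hn; apply: h; exists n.+1%:R^-1.
    by rewrite invr_gt0.
  move=> p q pqn; apply: contrapT => hC; exact: (hn (p, q)).
have [z pz] := nat_ultra_cvg (fun n => (pq n).1) cX.
have [z' qz'] := nat_ultra_cvg (fun n => (pq n).2) cX.
have zz' : z = z'.
  apply: contrapT => /eqP zz'; have d0 : 0 < mdist z z' / 3 by rewrite divr_gt0// mdist_gt0.
  have UI := nat_ultra_near (near_infty_natSinv_lt (PosNum d0)).
  have [n [/= nd [p1 q1]]] := filter_ex (filterI UI (filterI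
    (cvg_preimage pz (nbhsx_ballx z _ d0)) (cvg_preimage qz' (nbhsx_ballx z' _ d0)))).
  have [+ _] := pqP n; move: p1 q1 nd; rewrite /= !ballEmdist/= => p1 q1 nd pq1.
  have := metric_triangle z (pq n).1 z'.
  have := metric_triangle (pq n).1 (pq n).2 z'.
  have {}pq1 : mdist (pq n).1 (pq n).2 < mdist z z' / 3 by exact: lt_trans pq1 nd.
  rewrite (metric_sym (pq n).2 z'); clear nd; lra.
rewrite -zz' in qz'; have e2 : 0 < e / 2 by rewrite divr_gt0.
have [V [oV cV Vz Ve]] := lcX _ _ (nbhsx_ballx z _ e2).
have nV : nbhs z V by exact: open_nbhs_nbhs.
have [n [Vp Vq]] := filter_ex (filterI (cvg_preimage pz nV) (cvg_preimage qz' nV)).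
have [_] := pqP n; apply; exists V; split => // y /Ve.
move/Ve : (Vp); rewrite !ballEmdist/= => zp zy.
have := metric_triangle (pq n).1 z y.
rewrite (metric_sym _ z); lra.
Qed.

Section Continuity.
Context {T : topologicalType} (f : T -> T).

Lemma continuous_iter n : continuous f -> continuous (iter n f).
Proof.
move=> cf; elim: n => [|n IHn] x; first exact: cvg_id.
exact: (continuous_comp (IHn x) (cf _)).
Qed.

Lemma iter_fixed c N k : iter N f c = c -> iter (k * N) f c = c.
Proof. by move=> fc; rewrite iterM; elim: k => //= k ->. Qed.

End Continuity.

(** * Paths in locally connected continua *)

Section Chains.
Context {R : realType} {X : metricType R}.
Implicit Types (s t : nat -> X) (p q r u v : X).

(** The points reachable from p by [d]-chains inside [C] form a clopen subset of [C]. A chain rests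
    at q from time [m] on, so that it can be prolonged at will. *)
Lemma connected_chain (C : set X) (d : R) p q : connected C -> 0 < d -> C p -> C q ->
  exists s m, [/\ s 0%N = p, forall i, (m <= i)%N -> s i = q, forall i, C (s i) &
    forall i, mdist (s i) (s i.+1) < d].
Proof.
move=> cC d0 Cp Cq.
pose P r := exists s m, [/\ s 0%N = p, forall i, (m <= i)%N -> s i = r,
  forall i, C (s i) & forall i, mdist (s i) (s i.+1) < d].
have Pext r r' : P r -> C r' -> mdist r r' < d -> P r'.
  move=> [s [m [s0 sm sC sd]]] Cr' rr'.
  exists (fun i => if (i <= m)%N then s i else r'), m.+1; split => //.
  - by move=> i mi; rewrite leqNgt mi.
  - by move=> i; case: ifP.
  - move=> i; case: (ltngtP i m) => im; first exact: sd.
      by rewrite mdistxx.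
    by rewrite im (sm m).
suff : C `&` P = C by move=> /seteqP[_ /(_ q Cq)[]].
apply: cC.
- by exists p; split=> //; exists (fun=> p), 0%N; split => // i; rewrite mdistxx.
- exists (\bigcup_(r in C `&` P) (ball r d)^°).
    by apply: bigcup_open => r _; exact: open_interior.
  apply/seteqP; split => [r [Cr Pr]|r' [Cr' [r [Cr Pr]]]].
    by split => //; exists r; [split|exact: nbhsx_ballx].
  by move=> /nbhs_singleton; rewrite ballEmdist => rr'; split => //; exact: Pext rr'.
- exists (closure (C `&` P)); first exact: closed_closure.
  apply/seteqP; split => [r [Cr Pr]|r' [Cr' clr']].
    by split => //; exact: subset_closure.
  have [r [[Cr Pr]]] := clr' _ (nbhsx_ballx r' d d0).
  by rewrite ballEmdist/= metric_sym => rr'; split => //; exact: Pext rr'.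
Qed.

(** Each link is replaced by a fine chain inside a small connected set. All links receive the same
    number [K] of steps, so that step [j] refines step [j %/ K]. *)
Lemma refine_chain (e d d' : R) s L : 0 < e -> 0 < d' ->
  (forall p q, mdist p q < d ->
    exists C, [/\ connected C, C p, C q & C `<=` ball p e]) ->
  (forall i, (i < L)%N -> mdist (s i) (s i.+1) < d) ->
  exists K s', [/\ (0 < K)%N, s' 0%N = s 0%N, s' (L * K)%N = s L,
    forall j, (j < L * K)%N -> mdist (s' j) (s' j.+1) < d' &
    forall j, (j <= L * K)%N -> mdist (s (j %/ K)%N) (s' j) < e].
Proof.
move=> e0 d'0 ulc sd.
have /choice[tm tmP] (i : nat) : exists tm : (nat -> X) * nat,
    [/\ tm.1 0%N = s i, (i < L)%N -> forall k, (tm.2 <= k)%N -> tm.1 k = s i.+1,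
    forall k, mdist (tm.1 k) (tm.1 k.+1) < d' & forall k, mdist (s i) (tm.1 k) < e].
  have [iL|iL] := ltnP i L; last first.
    by exists (fun=> s i, 0%N); split => // k; rewrite mdistxx.
  have [C [cC Cs Cs' Ce]] := ulc _ _ (sd i iL).
  have [t [m [t0 tm tC td]]] := connected_chain cC d'0 Cs Cs'.
  exists (t, m); split => // k.
  by have := Ce _ (tC k); rewrite ballEmdist.
pose K := (\max_(i < L) (tm i).2).+1.
have K0 : (0 < K)%N by [].
have tmK i : (i < L)%N -> (tm i).1 K = s i.+1.
  move=> iL; have [_ h _ _] := tmP i; apply: h => //; apply: leqW.
  exact: (leq_bigmax (Ordinal iL)).
exists K, (fun j => (tm (j %/ K)%N).1 (j %% K)%N); split => //.
- by rewrite div0n mod0n; have [] := tmP 0%N.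
- by rewrite mulnK// modnMl; have [] := tmP L.
- move=> j jLK; have jL : (j %/ K < L)%N by rewrite ltn_divLR.
  have [_ _ h _] := tmP (j %/ K)%N.
  have [jK|jK] := ltnP (j %% K)%N.+1 K.
    have jE : j.+1 = (j %/ K * K + (j %% K).+1)%N by rewrite addnS -divn_eq.
    have -> : (j.+1 %/ K = j %/ K)%N by rewrite jE divnMDl// (divn_small jK) addn0.
    by have -> : (j.+1 %% K = (j %% K).+1)%N by rewrite {1}jE modnMDl (modn_small jK).
  have jK' : (j %% K)%N.+1 = K by apply/eqP; rewrite eqn_leq jK ltn_mod K0.
  have jE : j.+1 = ((j %/ K).+1 * K)%N by rewrite [in LHS](divn_eq j K) -addnS jK' mulSn addnC.
  rewrite jE mulnK// modnMl.
  have [-> _ _ _] := tmP (j %/ K)%N.+1.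
  by have := h (j %% K)%N; rewrite jK' (tmK _ jL).
- by move=> j _; have [_ _ _ h] := tmP (j %/ K)%N.
Qed.

Definition uniformly_continuous01 (p : R -> X) := forall e : R, 0 < e ->
  exists2 d : R, 0 < d & forall s t : R, 0 <= s -> s <= t -> t <= 1 -> t - s < d ->
    mdist (p s) (p t) < e.

End Chains.

Lemma truncn_div (R : realType) (t : R) (L K : nat) : 0 <= t -> (0 < K)%N ->
  (Num.truncn (t * (L * K)%:R) %/ K)%N = Num.truncn (t * L%:R).
Proof.
move=> t0 K0; symmetry; apply: truncn_def.
have tLK : 0 <= t * (L * K)%:R by rewrite mulr_ge0.
have /andP[h1 h2] := truncn_itv tLK; set j := Num.truncn _ in h1 h2 *.
have K0' : 0 < K%:R :> R by rewrite ltr0n.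
rewrite -(ler_pM2r K0') -(ltr_pM2r K0') -mulrA -!natrM; apply/andP; split.
  by apply: le_trans h1; rewrite ler_nat leq_divM.
by apply: lt_le_trans h2 _; rewrite ler_nat ltn_ceil.
Qed.

Section Paths.
Context {R : realType} {X : metricType R}.
Context (cptX : compact [set: X]) (lcX : locally_connected X).
Implicit Types (u v x y : X).

(** A chain in [E] is refined repeatedly, level n moving the samples by less than [e / 2 ^+ n.+1];
    the limits of the samples form a path. It need not stay in [E], only within [e] of it. *)
Lemma path_near (E : set X) u v (e : R) : connected E -> E u -> E v -> 0 < e ->
  exists p : R -> X, [/\ uniformly_continuous01 p, p 0 = u, p 1 = v &
    forall t, 0 <= t <= 1 -> exists2 x, E x & mdist x (p t) <= e].
Proof.
move=> cE Eu Ev e0; pose eps n := e / 2 ^+ n.+1.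
have eps0 n : 0 < eps n by rewrite divr_gt0// exprn_gt0.
have /choice[dl dlP] (n : nat) : exists d : R, 0 < d /\ forall p q : X, mdist p q < d ->
    exists C, [/\ connected C, C p, C q & C `<=` ball p (eps n)].
  by have [d d0 hd] := uniformly_locally_connected cptX lcX (eps0 n); exists d.
pose valid n (sL : (nat -> X) * nat) := (0 < sL.2)%N /\ forall i, (i < sL.2)%N ->
  mdist (sL.1 i) (sL.1 i.+1) < dl n.
pose next n (a b : (nat -> X) * nat) := exists2 K, (0 < K)%N &
  [/\ b.2 = (a.2 * K)%N, b.1 0%N = a.1 0%N, b.1 b.2 = a.1 a.2 &
    forall j, (j <= b.2)%N -> mdist (a.1 (j %/ K)%N) (b.1 j) < eps n].
have /choice[step stepP] (na : nat * ((nat -> X) * nat)) : exists b,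
    valid na.1 na.2 -> valid na.1.+1 b /\ next na.1 na.2 b.
  case: na => n [s L] /=; have [va|nva] := pselect (valid n (s, L)); last by exists (s, L).
  have [L0 sd] := va.
  have [K [s' [K0 s0 sL s'd ss']]] :=
    refine_chain (eps0 n) (dlP n.+1).1 (dlP n).2 sd.
  exists (s', (L * K)%N) => _; split; last by exists K.
  by split => //=; rewrite muln_gt0 L0.
have [s0 [m [s00 s0m s0E s0d]]] := connected_chain cE (dlP 0%N).1 Eu Ev.
(* The length [m.+1] is positive even when [m] is 0. *)
pose a := fix a n := if n is n'.+1 then step (n', a n') else (s0, m.+1).
have aV n : valid n (a n).
  by elim: n => [|n IHn]; [split => // i _; exact: s0d|have [] := stepP (n, a n) IHn].
have aN n : next n (a n) (a n.+1) by have [] := stepP (n, a n) (aV n).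
pose g n (t : R) := (a n).1 (Num.truncn (t * (a n).2%:R)).
have tL (t : R) n : t <= 1 -> (Num.truncn (t * (a n).2%:R) <= (a n).2)%N.
  move=> t1; rewrite truncn_le_nat; apply: (@le_lt_trans _ _ (a n).2%:R).
    by rewrite -[leRHS]mul1r ler_wpM2r.
  by rewrite ltr_nat.
have gS n t : 0 <= t -> t <= 1 -> mdist (g n t) (g n.+1 t) < eps n.
  move=> t0 t1; have [K K0 [aK _ _ h]] := aN n.
  have := h _ (tL t n.+1 t1); rewrite {1}aK.
  by rewrite truncn_div.
have gD n k t : 0 <= t -> t <= 1 -> mdist (g n t) (g (n + k)%N t) <= e / 2 ^+ n - e / 2 ^+ (n + k).
  move=> t0 t1; elim: k => [|k IHk]; first by rewrite addn0 subrr mdistxx.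
  have := gS (n + k)%N t t0 t1; rewrite addnS.
  have := metric_triangle (g n t) (g (n + k)%N t) (g (n + k).+1 t).
  have -> : e / 2 ^+ (n + k).+1 = eps (n + k)%N by [].
  have : e / 2 ^+ (n + k) = eps (n + k)%N + eps (n + k)%N.
    by rewrite /eps exprSr invfM mulrA -splitr.
  lra.
have /choice[p pP] (t : R) : exists z : X, (fun n => g n t) @ nat_ultra --> z.
  exact: nat_ultra_cvg.
have gp n t : 0 <= t -> t <= 1 -> mdist (g n t) (p t) <= e / 2 ^+ n.
  move=> t0 t1; apply/ler_addgt0Pr => d d0.
  have [k nk] := nat_ultra_ex n (cvg_preimage (pP t) (nbhsx_ballx _ _ d0)).
  rewrite /= ballEmdist/= => pk.
  have := gD n (k - n)%N t t0 t1; rewrite subnKC//.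
  have := metric_triangle (g n t) (g k t) (p t); rewrite (metric_sym (g k t)).
  have : 0 < e / 2 ^+ k by rewrite divr_gt0// exprn_gt0.
  lra.
exists p; split.
- move=> d d0.
  have [n nd] : exists n, e / 2 ^+ n < d / 3.
    exists (Num.truncn (e / (d / 3))); have d3 : 0 < d / 3 by rewrite divr_gt0.
    rewrite ltr_pdivrMr ?exprn_gt0// mulrC -ltr_pdivrMr//.
    apply: lt_le_trans (truncnS_gt _) _.
    by rewrite -natrX ler_nat; exact: ltn_expl.
  have [[L0 sd] [_ hdl]] := (aV n, dlP n).
  have L0' : 0 < (a n).2%:R :> R by rewrite ltr0n.
  (* Times closer than one sampling interval have equal or consecutive indices at level n. *)
  exists ((a n).2%:R^-1); first by rewrite invr_gt0.
  move=> s t s0' st t1 ts.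
  have h1 := gp n s s0' (le_trans st t1).
  have h2 := gp n t (le_trans s0' st) t1.
  suff h3 : mdist (g n s) (g n t) < d / 3.
    have := metric_triangle (p s) (g n s) (p t).
    have := metric_triangle (g n s) (g n t) (p t).
    rewrite (metric_sym (p s) (g n s)); lra.
  have sL0 : 0 <= s * (a n).2%:R by rewrite mulr_ge0.
  have stL : (Num.truncn (s * (a n).2%:R) <= Num.truncn (t * (a n).2%:R))%N.
    by apply: le_truncn; rewrite ler_wpM2r.
  have tsL : (Num.truncn (t * (a n).2%:R) <= (Num.truncn (s * (a n).2%:R)).+1)%N.
    rewrite truncn_le_nat -addn1 natrD.
    have /andP[_ h] := truncn_itv sL0.
    have : (t - s) * (a n).2%:R < 1 by rewrite -ltr_pdivlMr// mul1r.
    rewrite mulrBl -[X in _ < X + _]natr1 => h'; rewrite -natr1 in h; lra.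
  rewrite /g; have [ij|ij] := ltnP (Num.truncn (s * (a n).2%:R))
    (Num.truncn (t * (a n).2%:R)); last first.
    have -> : Num.truncn (s * (a n).2%:R) = Num.truncn (t * (a n).2%:R).
      by apply/eqP; rewrite eqn_leq stL.
    by rewrite mdistxx divr_gt0.
  have -> : Num.truncn (t * (a n).2%:R) = (Num.truncn (s * (a n).2%:R)).+1.
    by apply/eqP; rewrite eqn_leq tsL.
  have [|C [_ _ C2 Ce]] := hdl _ _ (sd (Num.truncn (s * (a n).2%:R)) _).
    exact: leq_trans ij (tL t n t1).
  have := Ce _ C2; rewrite ballEmdist/=.
  have : eps n <= e / 2 ^+ n.
    rewrite /eps ler_pM2l// lef_pV2 ?posrE ?exprn_gt0//.
    by rewrite exprS ler_peMl ?exprn_ge0// ler1n.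
  lra.
- have g0 n : g n 0 = u.
    rewrite /g mul0r truncn0; elim: n => [//|n IHn].
    by have [K K0 [_ -> _ _]] := aN n.
  apply: contrapT => /eqP pu; have d0 : 0 < mdist (p 0) u by rewrite mdist_gt0.
  have [k _] := nat_ultra_ex 0 (cvg_preimage (pP 0) (nbhsx_ballx _ _ d0)).
  by rewrite /= g0 ballEmdist/= ltxx.
- have g1 n : g n 1 = v.
    rewrite /g mul1r natrK; elim: n => [|n IHn]; first by rewrite /= s0m.
    by have [K K0 [_ _ -> _]] := aN n.
  apply: contrapT => /eqP pv; have d0 : 0 < mdist (p 1) v by rewrite mdist_gt0.
  have [k _] := nat_ultra_ex 0 (cvg_preimage (pP 1) (nbhsx_ballx _ _ d0)).
  by rewrite /= g1 ballEmdist/= ltxx.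
- move=> t /andP[t0 t1]; exists (g 0%N t); first exact: s0E.
  by have := gp 0%N t t0 t1; rewrite expr0 divr1.
Qed.

End Paths.

(** * Monotone paths and arcs *)

Lemma compact_chain_cover (T : topologicalType) (K : set T) (F : set (set T)) :
  compact K -> F !=set0 -> (forall U, F U -> open U) -> total_on F subset ->
  K `<=` \bigcup_(U in F) U -> exists2 U, F U & K `<=` U.
Proof.
move=> cK [U0 FU0] Fo Ftot KF; apply: contrapT => h.
pose G := filter_from F (fun U => K `&` ~` U).
have PG : ProperFilter G.
  apply: filter_from_proper; last first.
    move=> U FU; apply: contrapT => KU; apply: h; exists U => // x Kx.
    by apply: contrapT => Ux; apply: KU; exists x.
  apply: filter_from_filter; first by exists U0.
  move=> U V FU FV; have [UV|VU] := Ftot U V FU FV.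
    by exists V => // x [Kx Vx]; split; split => // /UV.
  by exists U => // x [Kx Ux]; split; split => // /VU.
have [|y [Ky cly]] := cK G PG; first by exists U0 => // x [].
have [U FU Uy] := KF y Ky.
have GU : G (K `&` ~` U) by exists U.
by have [x [[_ nUx] Ux]] := cly _ _ GU (open_nbhs_nbhs (conj (Fo U FU) Uy)).
Qed.

Section OpenGaps.
Context {R : realType}.
Implicit Types (U : set R) (s t r a b : R).

Lemma compact_itv_setC U a b : open U -> compact (`[a, b]%classic `&` ~` U).
Proof.
move=> oU; apply: compact_closedI; first exact: segment_compact.
exact: open_closedC.
Qed.

Lemma last_outside U s a : open U -> s <= a -> ~ U s ->
  exists2 r, s <= r <= a & ~ U r /\ forall t, r < t -> t <= a -> U t.
Proof.
move=> oU sa Us.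
have [||r + hr] := @compact_EVT_max R R id _ _ (compact_itv_setC (a := s) (b := a) oU).
- by exists s; split => //=; rewrite in_itv/= lexx.
- by apply: continuous_subspaceT => x; exact: cvg_id.
rewrite inE => -[/=]; rewrite in_itv/= => /andP[sr ra] Ur.
exists r; first by rewrite sr.
split => // t rt ta; apply: contrapT => Ut.
have := hr t; rewrite inE/= in_itv/= ta (le_trans sr (ltW rt)) => /(_ (conj isT Ut)).
by rewrite leNgt rt.
Qed.

Lemma first_outside U b t : open U -> b <= t -> ~ U t ->
  exists2 r, b <= r <= t & ~ U r /\ forall s, b <= s -> s < r -> U s.
Proof.
move=> oU bt Ut.
have oU' : open [set x | U (- x)] by apply: open_comp oU => x _; exact: opp_continuous.
have [||r] := @last_outside [set x | U (- x)] (- t) (- b) oU'.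
- by rewrite lerN2.
- by rewrite /= opprK.
move=> /andP[tr rb] [Ur hr]; exists (- r); first by rewrite lerNr rb lerNl tr.
split => // s bs sr; have := hr (- s); rewrite /= opprK; apply.
  by rewrite ltrNr.
by rewrite lerN2.
Qed.

End OpenGaps.

Section MonotonePath.
Context {R : realType} {X : metricType R} (p : R -> X).
Context (ucp : uniformly_continuous01 p).
Implicit Types (U V : set R) (s t r : R).

(** The last condition says that p agrees at the two ends of every gap, that is, of every maximal
    interval of [U] in [0, 1], so that p may be flattened there. *)
Let admissible U := [/\ open U, ~ U 0, ~ U 1 &
  forall s t, 0 <= s -> s < t -> t <= 1 -> ~ U s -> ~ U t ->
    (forall r, s < r -> r < t -> U r) -> p s = p t].

(** A gap of the union has a compact core lying in one member [U] of the chain. The ends of the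
    corresponding gap of [U] are within [h] of those of the given gap, so uniform continuity makes p
    agree at the latter. *)
Let admissible_bigcup (F : set (set R)) :
  F `<=` admissible -> total_on F subset -> admissible (\bigcup_(U in F) U).
Proof.
move=> FP Ftot; split.
- by apply: bigcup_open => U /FP[].
- by move=> [U /FP[]].
- by move=> [U /FP[]].
move=> s t s0 st t1 sF tF stF; apply: contrapT => /eqP; rewrite -mdist_gt0 => d0.
have d2 : 0 < mdist (p s) (p t) / 2 by rewrite divr_gt0.
have [e e0 he] := ucp d2.
pose h := Num.min (e / 2) ((t - s) / 3).
have h0 : 0 < h by rewrite lt_min !divr_gt0//= subr_gt0.
have he2 : h <= e / 2 by rewrite ge_min lexx.
have hts : h <= (t - s) / 3 by rewrite ge_min lexx orbT.
have [|||U FU hU] := compact_chain_cover (@segment_compact R (s + h) (t - h)) _ _ Ftot.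
- by have [||U FU _] := stF (s + h); [lra|lra|exists U].
- by move=> U /FP[].
- by move=> r /=; rewrite in_itv/= => /andP[sr rt]; apply: stF; lra.
have [oU U0 U1 Ugap] := FP U FU.
have Us : ~ U s by move=> Us; apply: sF; exists U.
have Ut : ~ U t by move=> Ut; apply: tF; exists U.
have [|s' /andP[ss' s'h] [Us' s'U]] := @last_outside R U s (s + h) oU _ Us; first by lra.
have [|t' /andP[ht' t't] [Ut' t'U]] := @first_outside R U (t - h) t oU _ Ut; first by lra.
have pst : p s' = p t'.
  apply: Ugap => //; [lra|lra|lra|move=> r s'r rt'].
  have [rsh|rsh] := leP r (s + h); first exact: s'U.
  have [trh|trh] := leP (t - h) r; first exact: t'U.
  by apply: hU; rewrite /= in_itv/=; apply/andP; split; lra.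
have h1 : mdist (p s) (p s') < mdist (p s) (p t) / 2 by apply: he; lra.
have h2 : mdist (p t') (p t) < mdist (p s) (p t) / 2 by apply: he; lra.
have := metric_triangle (p s) (p s') (p t); rewrite {2}pst; lra.
Qed.

(* The path is replaced by a constant on each gap of a maximal admissible set. *)
Lemma monotone_path : exists p' : R -> X, [/\ uniformly_continuous01 p',
  p' 0 = p 0, p' 1 = p 1,
  forall t, 0 <= t <= 1 -> exists2 s, 0 <= s <= 1 & p' t = p s &
  forall s t, 0 <= s -> s <= t -> t <= 1 -> p' s = p' t ->
    forall r, s <= r <= t -> p' r = p' s].
Proof.
have [U [[oU U0 U1 Ugap] Umax]] := Zorn_bigcup admissible_bigcup.
(* By maximality: if p agrees at s and t outside [U], adding the open interval between them to [U]
   keeps it admissible. *)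
have Uconst s t : 0 <= s -> s < t -> t <= 1 -> ~ U s -> ~ U t -> p s = p t ->
    forall r, s < r -> r < t -> U r.
  move=> s0 st t1 Us Ut pst; pose V := U `|` `]s, t[%classic.
  have : ~ (U `<` V).
    move=> /Umax; apply; split.
    - by apply: openU => //; exact: interval_open.
    - by move=> [//|/=]; rewrite in_itv/= => /andP[? _]; lra.
    - by move=> [//|/=]; rewrite in_itv/= => /andP[_ ?]; lra.
    move=> s1 t1' s10 st1 t11 Vs Vt hV.
    have Us1 : ~ U s1 by move=> ?; apply: Vs; left.
    have Ut1 : ~ U t1' by move=> ?; apply: Vt; left.
    have [t1s|st1'] := leP t1' s.
      apply: Ugap => // r r1 r2; have [//|/=] := hV r r1 r2.
      by rewrite in_itv/= => /andP[? _]; lra.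
    have [ts1|s1t] := leP t s1.
      apply: Ugap => // r r1 r2; have [//|/=] := hV r r1 r2.
      by rewrite in_itv/= => /andP[_ ?]; lra.
    have s1s : s1 <= s.
      by rewrite leNgt; apply/negP => ss1; apply: Vs; right; rewrite /= in_itv/= ss1.
    have tt1 : t <= t1'.
      by rewrite leNgt; apply/negP => t1t; apply: Vt; right; rewrite /= in_itv/= st1'.
    have -> : p s1 = p s.
      have [->//|ss1] := eqVneq s1 s.
      have s1s' : s1 < s by rewrite lt_neqAle ss1.
      apply: Ugap => //; first lra.
      move=> r r1 r2; have [//|/=] : V r by apply: hV; lra.
      by rewrite in_itv/= => /andP[? _]; lra.
    rewrite pst; have [->//|tt1'] := eqVneq t t1'.
    have tt1'' : t < t1' by rewrite lt_neqAle tt1'.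
    apply: Ugap => //; first lra.
    move=> r r1 r2; have [//|/=] : V r by apply: hV; lra.
    by rewrite in_itv/= => /andP[_ ?]; lra.
  move=> UV r sr rt; apply: contrapT => Ur; apply: UV; split; first by move=> x; left.
  by move=> /(_ r) h; apply: Ur; apply: h; right; rewrite /= in_itv/= sr.
(* [rho t] is the last time up to t outside [U]; thus [p \o rho] is constant on every gap. *)
have /choice[rho rhoP] (t : R) : exists r, 0 <= t -> [/\ 0 <= r, r <= t, ~ U r &
    forall s, r < s -> s <= t -> U s].
  have [t0|t0] := leP 0 t; last by exists t; rewrite leNgt t0.
  by have [r /andP[r0 rt] [Ur h]] := last_outside oU t0 U0; exists r.
have rhoid t : 0 <= t -> ~ U t -> rho t = t.
  move=> t0 Ut; have [r0 rt Ur h] := rhoP t t0.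
  by apply/eqP; rewrite eq_le rt leNgt; apply/negP => /h/(_ (lexx t)).
have rhomax t r : 0 <= t -> r <= t -> ~ U r -> r <= rho t.
  move=> t0 rt Ur; have [_ _ _ h] := rhoP t t0.
  by rewrite leNgt; apply/negP => /h/(_ rt).
have rhole s t : 0 <= s -> s <= t -> rho s <= rho t.
  move=> s0 st; have [_ rs Urs _] := rhoP s s0.
  by apply: rhomax => //; lra.
exists (p \o rho); split => /=.
- move=> e e0; have [d d0 hd] := ucp e0; exists d => // s t s0 st t1 ts /=.
  have t0 : 0 <= t by lra.
  have [rs0 rss Urs hs] := rhoP s s0; have [rt0 rtt Urt ht] := rhoP t t0.
  have [rts|srt] := ltP (rho t) s.
    suff -> : rho s = rho t by rewrite mdistxx.
    by apply/eqP; rewrite eq_le rhole//=; apply: rhomax => //; exact: ltW.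
  (* [rho s] and [r] are equal or bound a gap, and [r] and [rho t] both lie between s and t. *)
  have [r /andP[sr rrt] [Ur hr]] := first_outside oU srt Urt.
  have -> : p (rho s) = p r.
    have [->//|rsr] := eqVneq (rho s) r.
    have rsr' : rho s < r by rewrite lt_neqAle rsr; lra.
    apply: Ugap => //; first lra.
    move=> x rsx xr; have [xs|sx] := leP x s; first exact: hs.
    by apply: hr => //; exact: ltW.
  by apply: hd; lra.
- by rewrite rhoid.
- by rewrite rhoid.
- move=> t /andP[t0 t1]; have [r0 rt _ _] := rhoP t t0.
  by exists (rho t) => //; rewrite r0 (le_trans rt).
- move=> s t s0 st t1 pst r /andP[sr rt].
  have [t0 r0] : 0 <= t /\ 0 <= r by split; lra.
  have [rs0 rss Urs hs] := rhoP s s0; have [rt0 rtt Urt ht] := rhoP t t0.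
  have [rr0 rrr Urr hr] := rhoP r r0.
  have rsr := rhole s r s0 sr; have rrt := rhole r t r0 rt.
  have [e|rsr'] := eqVneq (rho s) (rho r); first by rewrite e.
  have [e|rrt'] := eqVneq (rho r) (rho t); first by rewrite e.
  case: Urr; apply: (Uconst (rho s) (rho t)) => //; rewrite ?lt_neqAle ?rsr' ?rrt'//=; lra.
Qed.

End MonotonePath.

(** On the compact set [A] the map [F] is closed, hence a quotient map onto its image; [phi]
    inherits continuity from [p]. *)
Lemma factor_continuous (Z Y W : topologicalType) (A : set Z) (F : Z -> Y)
    (p : Z -> W) (phi : Y -> W) : hausdorff_space Y -> compact A ->
  {within A, continuous F} -> {within A, continuous p} ->
  (forall z, A z -> phi (F z) = p z) -> {within F @` A, continuous phi}.
Proof.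
move=> hY cA cF cp phiF; apply/subspace_continuousP => _ [z0 Az0 <-] V.
rewrite nbhsE => -[V' [oV' V'z] V'V].
have {}V'z : V' (p z0) by rewrite -phiF.
have [D clD DA] : exists2 D, closed D & D `&` A = p @^-1` (~` V') `&` A.
  apply/closed_subspaceP; move/continuous_closedP: cp; apply.
  exact: open_closedC.
have cFD : closed (F @` (A `&` D)).
  apply: compact_closed => //; apply: continuous_compact.
    by apply: continuous_subspaceW cF => z [].
  exact: compact_closedI.
have : nbhs (F z0) (~` (F @` (A `&` D))).
  apply: open_nbhs_nbhs; split; first exact: closed_openC.
  move=> [z [Az Dz] Fz].
  have : (p @^-1` (~` V') `&` A) z by rewrite -DA.
  by move=> [/= + _]; rewrite -(phiF z)// Fz phiF.
apply: filterS => y /= nFD [z Az yE]; apply: V'V.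
suff : V' (p z) by rewrite -phiF// yE.
apply: contrapT => nV; apply: nFD; exists z => //; split => //.
have : (D `&` A) z by rewrite DA.
by case.
Qed.

Lemma within01_continuous (R : realType) (M : pseudoMetricType R) (g : R -> M) :
  (forall e : R, 0 < e -> exists2 d : R, 0 < d & forall s t : R,
    0 <= s -> s <= t -> t <= 1 -> t - s < d -> ball (g s) e (g t)) ->
  {within `[0, 1], continuous g}.
Proof.
move=> h; apply/subspace_continuousP => s; rewrite /= in_itv/= => /andP[s0 s1].
apply/cvg_ballP => e e0; have [d d0 hd] := h e e0.
apply: filterS (nbhsx_ballx s d d0) => t /= st; rewrite in_itv/= => /andP[t0 t1].
move: st; rewrite /ball/= => st.
have [ts|ts] := leP s t; first by apply: hd => //; move: st; rewrite ler0_norm; lra.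
by apply: ball_sym; apply: hd => //; [exact: ltW|move: st; rewrite ger0_norm; lra].
Qed.

(** * Reparametrization of a monotone path as an arc *)

Section Parametrization.
Context {R : realType} {X : metricType R} (p : R -> X).
Context (ucp : uniformly_continuous01 p).
Context (pmon : forall s t, 0 <= s -> s <= t -> t <= 1 -> p s = p t ->
  forall r, s <= r <= t -> p r = p s).
Implicit Types (s t r e : R) (k m : nat).

Let q k : R := if unpickle k is Some x then ratr (x : rat) else 0.

Let E k s : set R := [set x | x = 0 \/
  exists2 r, q k <= r <= s & x = Num.min 1 (mdist (p r) (p (q k)))].

(** The supremum of the distances from [p (q k)], cut off at 1, met between times [q k] and s; the
    extra element 0 of [E] makes it 0 before [q k]. *)
Let w k s := sup (E k s).

Let E_sup k s : has_sup (E k s).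
Proof.
split; first by exists 0; left.
by exists 1 => _ [->|[r _ ->]]; rewrite ?ler01// ge_min lexx.
Qed.

Let w_ge0 k s : 0 <= w k s.
Proof. by apply: ub_le_sup; [case: (E_sup k s)|left]. Qed.

Let w_le k s e : 0 <= e ->
  (forall r, q k <= r -> r <= s -> Num.min 1 (mdist (p r) (p (q k))) <= e) -> w k s <= e.
Proof.
move=> e0 h; apply: ge_sup; first by case: (E_sup k s).
by move=> _ [->//|[r /andP[? ?] ->]]; exact: h.
Qed.

Let w_ge k s r : q k <= r -> r <= s -> Num.min 1 (mdist (p r) (p (q k))) <= w k s.
Proof.
move=> qr rs; apply: ub_le_sup; first by case: (E_sup k s).
by right; exists r => //; rewrite qr.
Qed.

Let w_le1 k s : w k s <= 1.
Proof. by apply: w_le => // r _ _; rewrite ge_min lexx. Qed.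

Let w_mono k s t : s <= t -> w k s <= w k t.
Proof. by move=> st; apply: w_le => // r qr rs; apply: w_ge => //; lra. Qed.

Let w_osc k s t e : 0 <= s -> s <= t -> t <= 1 -> 0 < e ->
  (forall r r', s <= r -> r <= t -> s <= r' -> r' <= t -> mdist (p r) (p r') < e) ->
  w k t <= w k s + e.
Proof.
move=> s0 st t1 e0 h; have ws := w_ge0 k s; apply: w_le; first by lra.
move=> r qr rt; have [rs|sr] := leP r s; first by have := w_ge qr rs; lra.
have [qs|sq] := leP (q k) s; last first.
  by rewrite ge_min; apply/orP; right; have := h r (q k); lra.
have := w_ge qs (lexx s); have := h r s (ltW sr) rt (lexx s) st.
have := metric_triangle (p r) (p s) (p (q k)).
by rewrite !ge_min => h1 h2 /orP[h3|h3]; apply/orP; [left|right]; lra.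
Qed.

Let w_lt k s t : s < q k -> q k < t -> p (q k) != p t -> w k s < w k t.
Proof.
move=> sq qt pqt; apply: (@le_lt_trans _ _ 0).
  by apply: w_le => // r qr rs; lra.
apply: lt_le_trans (w_ge (ltW qt) (lexx t)).
by rewrite lt_min ltr01 mdist_gt0 eq_sym.
Qed.

Let S m s := \sum_(k < m) w k s / 2 ^+ k.+1.

Let S_sup s : has_sup (range (S ^~ s)).
Proof.
split; first by exists (S 0 s), 0%N.
exists 1 => _ [m _ <-]; suff : S m s <= 1 - 1 / 2 ^+ m.
  have : 0 < 1 / 2 ^+ m :> R by rewrite divr_gt0// exprn_gt0.
  lra.
rewrite /S; elim: m => [|m IHm]; first by rewrite big_ord0 expr0 divr1 subrr.
rewrite big_ord_recr/= (le_trans (lerD IHm (_ : _ <= 1 / 2 ^+ m.+1)))//.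
  by rewrite ler_pM2r ?invr_gt0 ?exprn_gt0.
rewrite exprSr invfM mulrA; lra.
Qed.

(* Summing over all rational starting times makes G strictly increasing wherever
   the path moves; G is constant where p is. *)
Let G s := sup (range (S ^~ s)).

Let G_le s t e : 0 <= e -> (forall k, w k t <= w k s + e) -> G t <= G s + e.
Proof.
move=> e0 h; apply: ge_sup; first by case: (S_sup t).
move=> _ [m _ <-]; apply: (@le_trans _ _ (S m s + e)); last first.
  by rewrite lerD2r; apply: ub_le_sup; [case: (S_sup s)|exists m].
suff : S m t <= S m s + e * (1 - 1 / 2 ^+ m).
  have : 0 <= e * (1 / 2 ^+ m) by rewrite mulr_ge0// divr_ge0// exprn_ge0.
  lra.
rewrite /S; elim: m => [|m IHm]; first by rewrite !big_ord0 expr0 divr1 subrr mulr0 addr0.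
rewrite !big_ord_recr/=.
have : w m t / 2 ^+ m.+1 <= (w m s + e) / 2 ^+ m.+1.
  by rewrite ler_pM2r ?invr_gt0 ?exprn_gt0.
move: IHm; rewrite exprSr invfM; lra.
Qed.

Let G_lt k s t : s <= t -> w k s < w k t -> G s < G t.
Proof.
move=> st wst; have c0 : 0 < (w k t - w k s) / 2 ^+ k.+1.
  by rewrite divr_gt0 ?subr_gt0// exprn_gt0.
suff : G s <= G t - (w k t - w k s) / 2 ^+ k.+1 by lra.
apply: ge_sup; first by case: (S_sup s).
have term i : w i s / 2 ^+ i.+1 <= w i t / 2 ^+ i.+1.
  by rewrite ler_pM2r ?invr_gt0 ?exprn_gt0// w_mono.
move=> _ [m _ <-].
have Smk : S m s <= S (m + k.+1) s.
  rewrite /S big_split_ord/= lerDl sumr_ge0// => i _.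
  by rewrite divr_ge0// exprn_ge0.
have kmk : (k < m + k.+1)%N by lia.
have : S (m + k.+1) s + (w k t - w k s) / 2 ^+ k.+1 <= S (m + k.+1) t.
  rewrite /S (bigD1 (Ordinal kmk))//= [leRHS](bigD1 (Ordinal kmk))//=.
  have : \sum_(i < m + k.+1 | i != Ordinal kmk) w i s / 2 ^+ i.+1 <=
    \sum_(i < m + k.+1 | i != Ordinal kmk) w i t / 2 ^+ i.+1 by exact: ler_sum.
  rewrite mulrBl; lra.
have : S (m + k.+1) t <= G t by apply: ub_le_sup; [case: (S_sup t)|exists (m + k.+1)%N].
lra.
Qed.

Let G_mono s t : s <= t -> G s <= G t.
Proof. by move=> st; rewrite -[leRHS]addr0; apply: G_le => // k; rewrite addr0 w_mono. Qed.

Let G_const s t : 0 <= s -> s <= t -> t <= 1 -> p s = p t -> G s = G t.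
Proof.
move=> s0 st t1 pst; apply/eqP; rewrite eq_le G_mono//=; apply/ler_addgt0Pr => e e0.
apply: G_le; first exact: ltW.
move=> k; apply: w_osc => // r r' sr rt sr' rt'.
by rewrite !(pmon s0 st t1 pst) ?mdistxx// ?sr ?sr'.
Qed.

Let G_inj s t : 0 <= s -> s <= t -> t <= 1 -> p s != p t -> G s < G t.
Proof.
move=> s0 st t1 pst; have [d d0 hd] := ucp (e := mdist (p s) (p t)) ltac:(by rewrite mdist_gt0).
have st' : s < t by rewrite lt_neqAle st andbT; apply: contra_neq pst => ->.
(* A rational time x so close after s that [p x] is nearer to [p s] than [p t] is, whence [p x]
   differs from [p t]. *)
have [|x] := @rat_in_itvoo R s (Num.min t (s + d)).
  by rewrite lt_min st' ltrDl d0.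
rewrite in_itv/= lt_min => /and3P[sx xt xd].
have qx : q (pickle x) = ratr x by rewrite /q pickleK.
apply: (G_lt (k := pickle x)) => //; apply: w_lt; rewrite qx//.
apply/eqP => pxt; have := hd s (ratr x) s0 (ltW sx).
by rewrite pxt ltxx => h; suff : false by []; apply: h; lra.
Qed.

Let G_cont e : 0 < e -> exists2 d, 0 < d & forall s t,
  0 <= s -> s <= t -> t <= 1 -> t - s < d -> G t - G s <= e.
Proof.
move=> e0; have [d d0 hd] := ucp e0; exists d => // s t s0 st t1 ts.
suff : G t <= G s + e by lra.
apply: G_le; first exact: ltW.
move=> k; apply: w_osc => // r r' sr rt sr' rt'.
by have [rr'|/ltW r'r] := leP r r'; [|rewrite metric_sym]; apply: hd; lra.
Qed.

(** The rescaled sum [H] maps [0, 1] onto [-1, 1] and identifies two times exactly when p does, so p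
    factors through [H] as an injective map. *)
Lemma arc_parametrization : p 0 != p 1 -> exists h : R -> X,
  [/\ {within `[-1, 1], continuous h},
      {in `[-1, 1] &, injective h}, h (-1) = p 0, h 1 = p 1 &
      forall y, -1 <= y <= 1 -> exists2 s, 0 <= s <= 1 & h y = p s].
Proof.
move=> p01; have G01 : 0 < G 1 - G 0 by rewrite subr_gt0 G_inj.
pose H s := (G s - G 0) / (G 1 - G 0) * 2 - 1.
have H0 : H 0 = -1 by rewrite /H subrr mul0r mul0r sub0r.
have H1 : H 1 = 1 by rewrite /H divff ?gt_eqF// mul1r; lra.
have cH : {within `[0, 1], continuous H}.
  apply: within01_continuous => e e0.
  have [|d d0 hd] := @G_cont (e * (G 1 - G 0) / 4); first by rewrite divr_gt0// mulr_gt0.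
  exists d => // s t s0 st t1 ts; rewrite /ball/= /H.
  have -> : (G s - G 0) / (G 1 - G 0) * 2 - 1 - ((G t - G 0) / (G 1 - G 0) * 2 - 1) =
    - ((G t - G s) / (G 1 - G 0) * 2) by ring.
  rewrite normrN ger0_norm; last first.
    by rewrite mulr_ge0// divr_ge0 ?subr_ge0 ?G_mono// ltW.
  have : (G t - G s) / (G 1 - G 0) <= e / 4.
    by rewrite ler_pdivrMr//; have := hd s t s0 st t1 ts; lra.
  lra.
have cp : {within `[0, 1], continuous p}.
  apply: within01_continuous => e /ucp[d d0 hd]; exists d => // s t s0 st t1 ts.
  by rewrite ballEmdist/=; exact: hd.
have HG s t : H s = H t -> G s = G t.
  move=> /addIr /(mulIf _) h; apply: (@addIr _ (- G 0)).
  by apply: (@mulIf _ (G 1 - G 0)^-1); [rewrite invr_eq0 gt_eqF|apply: h].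
have Hp s t : 0 <= s <= 1 -> 0 <= t <= 1 -> (H s = H t <-> p s = p t).
  wlog st : s t / s <= t => [hw|] s01 t01.
    have [/hw|/ltW/hw] := leP s t; first exact.
    by move=> /(_ t01 s01) [h1 h2]; split => /esym ?; apply/esym; auto.
  move/andP: s01 t01 => [s0 s1] /andP[t0 t1]; split => [/HG|] e.
    by apply/eqP; apply: contraT => /(G_inj s0 st t1); rewrite e ltxx.
  by rewrite /H (G_const s0 st t1 e).
have Hsurj y : -1 <= y <= 1 -> exists2 s, 0 <= s <= 1 & H s = y.
  move=> y1; have [||s] := @IVT R H 0 1 y _ cH.
  - exact: ler01.
  - by rewrite H0 H1 minElt maxElt; have -> : (-1 : R) < 1 by lra.
  by rewrite in_itv/=; exists s.
have /choice[sg sgP] (y : R) : exists s, -1 <= y <= 1 -> 0 <= s <= 1 /\ H s = y.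
  have [|y1] := boolP (-1 <= y <= 1); last by exists 0.
  by move=> /Hsurj[s s01 Hs]; exists s.
have HI s : 0 <= s <= 1 -> -1 <= H s <= 1.
  move=> /andP[s0 s1]; rewrite /H.
  have : 0 <= (G s - G 0) / (G 1 - G 0) by rewrite divr_ge0 ?subr_ge0 ?G_mono// ltW.
  have : (G s - G 0) / (G 1 - G 0) <= 1.
    by rewrite ler_pdivrMr// mul1r lerD2r G_mono.
  lra.
exists (p \o sg); split => /=.
- apply: (@continuous_subspaceW _ _ _ (H @` `[0, 1])).
    by move=> y; rewrite /= in_itv/= => /Hsurj[s s01 <-]; exists s => //=; rewrite in_itv.
  apply: (factor_continuous _ _ cH cp) => //.
  + exact: segment_compact.
  move=> s; rewrite /= in_itv/= => s01.
  have [sg01 HH] := sgP _ (HI s s01); exact/(Hp _ _ sg01 s01).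
- move=> y y'; rewrite !in_itv/= => y1 y1' pyy'.
  have [s01 Hs] := sgP y y1; have [s01' Hs'] := sgP y' y1'.
  by rewrite -Hs -Hs'; apply/(Hp _ _ s01 s01').
- have s00 : 0 <= (0 : R) <= 1 by apply/andP; split; [exact: lexx|exact: ler01].
  have [s01 Hs] := sgP _ (HI 0 s00).
  by rewrite -H0; exact/(Hp _ _ s01 s00).
- have s11 : 0 <= (1 : R) <= 1 by apply/andP; split; [exact: ler01|exact: lexx].
  have [s01 Hs] := sgP _ (HI 1 s11).
  by rewrite -{1}H1; exact/(Hp _ _ s01 s11).
- by move=> y /sgP[s01 _]; exists (sg y).
Qed.

End Parametrization.

(** * Points of a dendrite are separated by points *)

Definition separated_points (T : topologicalType) :=
  forall u v : T, u != v -> exists w, [/\ w != u, w != v & btw u w v].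

Lemma within_comp (Z Y W : topologicalType) (A : set Z) (B : set Y)
    (a : Z -> Y) (h : Y -> W) (H : Z -> W) : {within B, continuous h} ->
  continuous a -> (forall z, A z -> B (a z) /\ H z = h (a z)) ->
  {within A, continuous H}.
Proof.
move=> /subspace_continuousP ch ca aE; apply/subspace_continuousP => z Az V.
have [Baz Hz] := aE z Az; move=> HV.
have nV : nbhs (h (a z)) V by rewrite -Hz.
have nz : nbhs z (fun x => B (a x) -> V (h (a x))) := ca z _ (ch _ Baz _ nV).
apply: (filterS _ nz) => x BV Ax.
have [Bax Hx] := aE x Ax.
by have : V (H x) by rewrite Hx; exact: BV.
Qed.

Lemma compact_within_preimage (Z W : topologicalType) (A : set Z) (K : set W)
    (p : Z -> W) : compact A -> {within A, continuous p} -> closed K ->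
  compact (A `&` p @^-1` K).
Proof.
move=> cA cp clK.
have [D clD DA] : exists2 D, closed D & D `&` A = p @^-1` K `&` A.
  by apply/closed_subspaceP; move/continuous_closedP: cp; exact.
by rewrite setIC -DA setIC; exact: compact_closedI.
Qed.

(** * Two arcs sharing only their ends form a simple closed curve *)

Section ThetaCurve.
Context {R : realType} {X : metricType R} (h1 h2 : R -> X).
Context (ch1 : {within `[-1, 1], continuous h1}) (ch2 : {within `[-1, 1], continuous h2}).
Context (ih1 : {in `[-1, 1] &, injective h1}) (ih2 : {in `[-1, 1] &, injective h2}).
Context (hm1 : h1 (-1) = h2 (-1)) (h11 : h1 1 = h2 1).
Context (h12 : forall x y : R, x \in `[-1, 1] -> y \in `[-1, 1] -> h1 x = h2 y ->
  (x = -1 /\ y = -1) \/ (x = 1 /\ y = 1)).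

Let up (x : R) := (x, Num.sqrt (1 - x ^+ 2)).
Let low (x : R) := (x, - Num.sqrt (1 - x ^+ 2)).

Let csqrt : continuous (fun x : R => Num.sqrt (1 - x ^+ 2)).
Proof.
move=> x; apply: (@continuous_comp _ _ _ (fun x : R => 1 - x ^+ 2)); last exact: sqrt_continuous.
by apply: cvgB; [exact: cvg_cst|exact: exprn_continuous].
Qed.

Let cup : compact (up @` `[-1, 1]).
Proof.
apply: continuous_compact; last exact: segment_compact.
apply: continuous_subspaceT => x; exact: (cvg_pair cvg_id (@csqrt x)).
Qed.

Let clow : compact (low @` `[-1, 1]).
Proof.
apply: continuous_compact; last exact: segment_compact.
by apply: continuous_subspaceT => x; exact: (cvg_pair cvg_id (cvgN (@csqrt x))).
Qed.

Let sq1 (x : R) : x \in `[-1, 1] -> 0 <= 1 - x ^+ 2.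
Proof. by rewrite in_itv/= => /andP[? ?]; nra. Qed.

Let circleE : unit_circle (R := R) = up @` `[-1, 1] `|` low @` `[-1, 1].
Proof.
apply/seteqP; split => [[x y]|z] /=; rewrite /unit_circle /=.
  move=> xy; have x1 : x \in `[-1, 1] by rewrite in_itv/=; apply/andP; split; nra.
  have [y0|y0] := leP 0 y; [left|right]; exists x => //; congr pair.
    by rewrite -xy addrC addKr sqrtr_sqr ger0_norm.
  by rewrite -xy addrC addKr sqrtr_sqr ltr0_norm// opprK.
by move=> [[x x1 <-]|[x x1 <-]] /=; rewrite ?sqrrN sqr_sqrtr ?sq1// subrKC.
Qed.

(** The upper half circle carries [h1] and the lower one [h2], both through the abscissa; at the
    common points, with abscissa -1 and 1, they agree. *)
Let H (z : R * R) := if 0 <= z.2 then h1 z.1 else h2 z.1.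

Let Hup x : H (up x) = h1 x.
Proof. by rewrite /H /= sqrtr_ge0. Qed.

Let Hlow x : x \in `[-1, 1] -> H (low x) = h2 x.
Proof.
move=> x1; rewrite /H /= oppr_ge0; case: ifP => // s0.
have : Num.sqrt (1 - x ^+ 2) == 0 by rewrite eq_le s0 sqrtr_ge0.
rewrite sqrtr_eq0 => s1; have x2 : x ^+ 2 == 1.
  by rewrite eq_le; move: (sq1 x1) s1; rewrite subr_ge0 subr_le0 => -> ->.
by move: x2; rewrite sqrf_eq1 => /orP[] /eqP ->.
Qed.

Let cH : {within unit_circle (R := R), continuous H}.
Proof.
rewrite circleE; apply: withinU_continuous.
- by apply: compact_closed cup; exact: norm_hausdorff.
- by apply: compact_closed clow; exact: norm_hausdorff.
- apply: (within_comp ch1 (a := fst)); first by move=> z; exact: cvg_fst.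
  by move=> _ [x x1 <-]; rewrite Hup.
- apply: (within_comp ch2 (a := fst)); first by move=> z; exact: cvg_fst.
  by move=> _ [x x1 <-]; rewrite Hlow.
Qed.

Let Hinj z z' : unit_circle z -> unit_circle z' -> H z = H z' -> z = z'.
Proof.
have up_low x y : x \in `[-1, 1] -> y \in `[-1, 1] -> h1 x = h2 y -> up x = low y.
  move=> x1 y1 /(h12 x1 y1)[|] [-> ->]; rewrite /up /low.
    by rewrite sqrrN expr1n subrr sqrtr0 oppr0.
  by rewrite expr1n subrr sqrtr0 oppr0.
rewrite circleE => -[|] [x x1 <-] [|] [y y1 <-]; rewrite ?Hup ?Hlow//.
- by move=> /ih1 ->.
- exact: up_low.
- by move=> /esym/up_low ->.
- by move=> /ih2 ->.
Qed.

(** The inverse of the continuous injection [H] is continuous because the circle is compact: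
    [factor_continuous] is applied to the identity. *)
Lemma theta_simple_closed_curve : exists S : set X, simple_closed_curve S.
Proof.
have /choice[g gP] (x : X) : exists z, (exists2 z', unit_circle z' & H z' = x) ->
    unit_circle z /\ H z = x.
  have [[z' Cz' Hz']|nz] := pselect (exists2 z', unit_circle z' & H z' = x).
    by exists z'.
  by exists (0, 0).
have gH z : unit_circle z -> g (H z) = z.
  by move=> Cz; have [|Cg] := gP (H z); [exists z|exact: Hinj].
have cC : compact (unit_circle (R := R)) by rewrite circleE; exact: compactU.
exists (H @` unit_circle (R := R)), H, g; split => //.
- apply: (factor_continuous (p := id) _ cC cH _ gH); first exact: metric_hausdorff.
  by apply: continuous_subspaceT => z; exact: cvg_id.
- apply/seteqP; split => [_ [_ [z Cz <-] <-]|z Cz]; first by rewrite gH.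
  by exists (H z); [exists z|exact: gH].
Qed.

End ThetaCurve.

Lemma affine_path (R : realType) (X : metricType R) (p : R -> X) (a b : R) :
  0 <= a -> a <= b -> b <= 1 -> uniformly_continuous01 p ->
  uniformly_continuous01 (fun t => p (a + t * (b - a))).
Proof.
move=> a0 ab b1 ucp e /ucp[d d0 hd]; exists d => // s t s0 st t1 ts.
have ba : b - a <= 1 by lra.
apply: hd; [nra|nra|nra|].
by apply: le_lt_trans ts; nra.
Qed.

Lemma path_arc (R : realType) (X : metricType R) (p : R -> X) :
  uniformly_continuous01 p -> p 0 != p 1 -> exists h : R -> X,
  [/\ {within `[-1, 1], continuous h},
      {in `[-1, 1] &, injective h}, h (-1) = p 0, h 1 = p 1 &
      forall y, -1 <= y <= 1 -> exists2 s, 0 <= s <= 1 & h y = p s].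
Proof.
move=> ucp p01; have [p' [ucp' p'0 p'1 p'p p'mon]] := monotone_path ucp.
have [|h [ch ih hm1 h1 hp]] := arc_parametrization ucp' p'mon; first by rewrite p'0 p'1.
exists h; rewrite hm1 h1; split => // y /hp[s /p'p[t t01 pe] he].
by exists t => //; rewrite he pe.
Qed.

Lemma dendrite_separated_points (R : realType) (X : metricType R) :
  dendrite X -> separated_points X.
Proof.
move=> [cptX cX lcX noS] u v uv; apply: contrapT => /forallNP nsep; apply: noS.
have nbtw w : w != u -> w != v -> ~ btw u w v.
  by move=> wu wv uwv; apply: (nsep w).
have [al [ucal al0 al1 _]] := path_near cptX lcX (E := setT) (u := u) (v := v) cX I I ltr01.
have [|h [ch ih hm1 h1 _]] := path_arc ucal; first by rewrite al0 al1.
rewrite {}al0 {}al1 in hm1 h1.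
have m1I : (-1 : R) \in `[-1, 1] by rewrite in_itv/=; lra.
have oI : (1 : R) \in `[-1, 1] by rewrite in_itv/=; lra.
have zI : (0 : R) \in `[-1, 1] by rewrite in_itv/=; lra.
have hu : h 0 != u.
  by rewrite -hm1; apply/eqP => /(ih _ _ zI m1I); lra.
have hv : h 0 != v.
  by rewrite -h1; apply/eqP => /(ih _ _ zI oI); lra.
have [E [oE cE Eu Ev /existsNP[B /not_implyP[/nbhs_ballP[r /= r0 rB] EB]]]] :=
  nbtw_connected lcX (nbtw _ hu hv).
(* The ball of radius r about the midpoint misses [E]; a path within r / 2 of [E] therefore avoids
   the midpoint. *)
have r2 : 0 < r / 2 by rewrite divr_gt0.
have [be [ucbe be0 be1 beE]] := path_near cptX lcX cE Eu Ev r2.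
have bew t : 0 <= t <= 1 -> be t <> h 0.
  move=> /beE[x Ex xt] bh; apply: EB; exists x; split => //; apply: rB.
  by rewrite ballEmdist/= metric_sym -bh; lra.
have cbe : {within `[0, 1], continuous be}.
  apply: within01_continuous => e /ucbe[d d0 hd]; exists d => // s t s0 st t1 ts.
  by rewrite ballEmdist/=; exact: hd.
have clh a b : -1 <= a -> b <= 1 -> closed (h @` `[a, b]).
  move=> a1 b1; apply: compact_closed; first exact: metric_hausdorff.
  apply: continuous_compact; last exact: segment_compact.
  apply: continuous_subspaceW ch => y; rewrite /= !in_itv/= => /andP[ay yb].
  by apply/andP; split; lra.
(* [be] leaves the first half of the arc for the last time at [s0] before
   reaching the second half for the first time at [s1] *)
have hI (y : R) : -1 <= y <= 1 -> y \in `[-1, 1] by rewrite in_itv.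
have [|||s1] := @compact_EVT_min R R id (`[0, 1] `&` be @^-1` (h @` `[0, 1])).
- exists 1; split; first by rewrite /= in_itv/= lexx ler01.
  by exists 1; [rewrite /= in_itv/= lexx ler01|rewrite be1].
- by apply: compact_within_preimage => //; [exact: segment_compact|apply: clh; lra].
- by apply: continuous_subspaceT => x; exact: cvg_id.
rewrite inE /= in_itv/= => -[/andP[s10 s11] [y1]].
rewrite in_itv/= => /andP[y10 y11] hy1 s1min.
have cbe1 : {within `[0, s1], continuous be}.
  apply: continuous_subspaceW cbe => s; rewrite /= !in_itv/= => /andP[? ?].
  by apply/andP; split; lra.
have [|||s0] := @compact_EVT_max R R id (`[0, s1] `&` be @^-1` (h @` `[-1, 0])).
- exists 0; split; first by rewrite /= in_itv/= lexx.
  by exists (-1); [rewrite /= in_itv/= lexx; lra|rewrite be0].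
- by apply: compact_within_preimage => //; [exact: segment_compact|apply: clh; lra].
- by apply: continuous_subspaceT => x; exact: cvg_id.
rewrite inE /= in_itv/= => -[/andP[s00 s01] [y0]].
rewrite in_itv/= => /andP[y0m y00] hy0 s0max.
have s0I : 0 <= s0 <= 1 by lra.
have s1I : 0 <= s1 <= 1 by lra.
have y0lt : y0 < 0.
  rewrite lt_neqAle y00 andbT; apply/eqP => y0e; apply: (bew s0 s0I).
  by rewrite -hy0 y0e.
have y1gt : 0 < y1.
  rewrite lt_neqAle y10 andbT; apply/eqP => y1e; apply: (bew s1 s1I).
  by rewrite -hy1 -y1e.
have y0y1 : h y0 != h y1 by apply/eqP => /ih e; have := e (hI _ _) (hI _ _); lra.
have s0s1 : s0 < s1.
  by rewrite lt_neqAle s01 andbT; apply: contra_neq y0y1 => e; rewrite hy0 hy1 e.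
have off s y : s0 < s -> s < s1 -> -1 <= y <= 1 -> h y <> be s.
  move=> s0s ss1 /andP[ym yp] hys; have [y0'|y0'] := leP 0 y.
    have := s1min s; rewrite inE /= in_itv/= => h0.
    suff : s1 <= s by lra.
    apply: h0; split; first by lra.
    by exists y => //; rewrite in_itv/= y0'.
  have := s0max s; rewrite inE /= in_itv/= => h0.
  suff : s <= s0 by lra.
  apply: h0; split; first by lra.
  by exists y => //; rewrite in_itv/= ym ltW.
(* The piece of [be] from s0 to s1 meets the arc only in its ends; an arc inside it and the piece of
   [h] from y0 to y1 form the closed curve. *)
have [|h2 [ch2 ih2 h2m h21 h2be]] := path_arc
    (affine_path (andP s0I).1 (ltW s0s1) (andP s1I).2 ucbe).
  by rewrite mul0r addr0 mul1r subrKC -hy0 -hy1.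
rewrite mul0r addr0 -hy0 in h2m; rewrite mul1r subrKC -hy1 in h21.
pose a y := y0 + (y + 1) / 2 * (y1 - y0).
have aI y : -1 <= y <= 1 -> -1 <= a y <= 1.
  by move=> /andP[? ?]; rewrite /a; apply/andP; split; nra.
have am : a (-1) = y0 by rewrite /a addNr mul0r mul0r addr0.
have a1 : a 1 = y1 by rewrite /a -[1 + 1]/2 divff// mul1r subrKC.
have ainj : injective a.
  move=> x y /addrI /mulIf; rewrite subr_eq0 gt_eqF; last by lra.
  by move=> /(_ isT)/(@mulIf _ 2^-1); rewrite invr_eq0 pnatr_eq0 => /(_ isT)/addIr.
apply: (@theta_simple_closed_curve _ _ (h \o a) h2) => //.
- apply: (within_comp ch (a := a)).
    move=> y; apply: cvgD; first exact: cvg_cst.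
    apply: cvgMl; apply: cvgMl; apply: cvgD; first exact: cvg_id.
    exact: cvg_cst.
  by move=> y; rewrite /= !in_itv/= => /aI.
- move=> x y; rewrite !in_itv/= => /aI x1 /aI y1' /= /ih e; apply: ainj.
  by apply: e; exact: hI.
- by rewrite /= am h2m.
- by rewrite /= a1 h21.
move=> x y; rewrite !in_itv/= => x1 yI /= hxy.
have [t /andP[t0 t1] h2y] := h2be y yI.
have end_pt (z : R) : -1 <= z <= 1 -> h2 y = h2 z -> h (a z) = h2 z -> x = z /\ y = z.
  move=> zI' yz hz; split; last by apply: ih2 => //; exact: hI.
  by apply: ainj; apply: ih; [exact/hI/aI|exact/hI/aI|rewrite hz -yz].
have [te|t0'] := eqVneq t 0.
  left; apply: end_pt; [by move: m1I; rewrite in_itv|..|by rewrite am h2m].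
  by rewrite h2y te mul0r addr0 -hy0.
have [te|t1'] := eqVneq t 1.
  right; apply: end_pt; [by move: oI; rewrite in_itv|..|by rewrite a1 h21].
  by rewrite h2y te mul1r subrKC -hy1.
have t0s : 0 < t by rewrite lt_neqAle eq_sym t0'.
have t1s : t < 1 by rewrite lt_neqAle t1'.
case: (off (s0 + t * (s1 - s0)) (a x)); [nra|nra|exact: aI|by rewrite -h2y].
Qed.

(** * Fixed points and medians *)

Section Tree.
Context {R : realType} {X : metricType R}.
Context (cptX : compact [set: X]) (cX : connected [set: X]).
Context (lcX : locally_connected X) (sepX : separated_points X).
Implicit Types x y z p q : X.

Lemma closed_compact (K : set X) : closed K -> compact K.
Proof. by move=> clK; apply: subclosed_compact clK cptX _. Qed.

(** Among the points of the arc from y to z outside [V], let m be one nearest to y. A point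
    separating y from m is nearer still, hence in [V]. *)
Lemma btw_dense y z U : y != z -> nbhs y U ->
  exists w, [/\ U w, w != y & btw y w z].
Proof.
rewrite nbhsE => yz [V [oV Vy] VU].
have [zV|zV] := pselect (V z); first by exists z; split; [exact: VU|rewrite eq_sym|].
pose K := [set p | btw y p z] `&` ~` V.
have clK : closed K by apply: closedI; [exact: btw_closed_mid|exact: open_closedC].
have [|||||m [yml Vm] mmax] := @compact_maximal X K (fun p r => btw y r p).
- exact: closed_compact.
- by exists z; split.
- by move=> x.
- by move=> a b c ba cb; exact: btw_transl ba cb.
- by move=> x; exact: btw_closed_mid.
have [|w [wy wm ywm]] := sepX (u := y) (v := m).
  by apply/eqP => ym; apply: Vm; rewrite -ym.
have ywz : btw y w z by exact: btw_transl yml ywm.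
exists w; split => //; apply: VU; apply: contrapT => wV.
have /(_ ywm) ymw := mmax w (conj ywz wV).
by rewrite (btw_anti lcX cX ywm ymw) eqxx in wm.
Qed.

(* A maximal p, for the order of distance from x0, with p between x0 and g p is
   fixed: otherwise points slightly beyond p towards g p have this property too. *)
Lemma convex_fixed_point (K : set X) (g : X -> X) : closed K -> K !=set0 ->
  (forall p q z, K p -> K q -> btw p z q -> K z) -> continuous g ->
  g @` K `<=` K -> exists2 c, K c & g c = c.
Proof.
move=> clK [x0 Kx0] convK cg gK.
pose Q := K `&` [set p | btw x0 p (g p)].
have clQ : closed Q.
  apply: closedI => // p pc; apply: contrapT => /(nbtw_open lcX)[E oE [Ex Ey hp]].
  have : nbhs p ((fun p' => forall x' y', E x' -> E y' -> ~ btw x' p' y') `&` g @^-1` E).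
    by apply: filterI => //; apply: cg; exact: open_nbhs_nbhs.
  by move=> /pc[q [/= h1 [h2 h3]]]; exact: (h2 _ _ Ex h3).
have [|||||y [Ky yQ] ymax] := @compact_maximal X Q (fun p r => btw x0 p r).
- exact: closed_compact.
- by exists x0; split.
- by move=> x.
- by move=> a b c ab bc; exact: btw_transl bc ab.
- by move=> x; exact: btw_closed_end.
exists y => //; apply: contrapT => /eqP gy; rewrite eq_sym in gy.
have [w [wy wg ywg]] := sepX gy.
have [A [B [yA gB AB]]] := btw_open2 lcX ywg wy wg.
have yw : y != w by rewrite eq_sym.
(* For z near y, the point w still separates z from [g z]; z is taken beyond y on the arc towards w,
   which contradicts the maximality of y. *)
have : nbhs y (A `&` (g @^-1` B) `&` ~` [set w]).
  by apply: filterI; [apply: filterI => //; exact: cg|exact: nbhs_neq].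
move=> /(btw_dense yw)[z [[[Az Bz] zw] zy yzw]].
have wgz : btw z w (g z) by exact: AB.
have x0yw : btw x0 y w by exact: (btw_chain lcX cX (y := g y)).
have x0zw : btw x0 z w by exact: (btw_transr x0yw).
have Kgy : K (g y) by apply: gK; exists y.
have Qz : Q z.
  split; first exact: (convK _ _ _ Ky Kgy (btw_transl ywg yzw)).
  have [//|wzg] := btw_split (g z) x0zw.
  by case: zw; rewrite /= (btw_anti lcX cX (btwC wgz) wzg).
have x0yz : btw x0 y z by apply: (btw_chain lcX cX x0yw yzw); rewrite eq_sym.
by have := btw_anti lcX cX (ymax _ Qz x0yz) x0yz => zy'; rewrite zy' eqxx in zy.
Qed.

Definition median x y z m := [/\ btw x m y, btw y m z & btw x m z].

(** Take for m the last common point of the arcs from x to y and from x to z. If it were not between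
    y and z, points slightly beyond it towards z would still be common. *)
Lemma median_exists x y z : exists m, median x y z m.
Proof.
have clK : closed ([set m | btw x m y] `&` [set m | btw x m z]).
  by apply: closedI; exact: btw_closed_mid.
have [||||m [/= xmy xmz] mmax] := @compact_maximal X _ (fun p r => btw x p r) (closed_compact clK).
- by exists x; split.
- by move=> a.
- by move=> a b c ab bc; exact: btw_transl bc ab.
- by move=> a; exact: btw_closed_end.
exists m; split => //; apply: contrapT => ymz.
have mz : m != z by apply/eqP => mz; apply: ymz; rewrite mz.
have [E oE [Ey Ez hm]] := nbtw_open lcX ymz.
have [w [hw wm mwz]] := btw_dense mz hm.
have xwz : btw x w z by exact: btw_transr xmz mwz.
have [xwy|ywz] := btw_split y xwz; last by case: (hw _ _ Ey Ez).
have xmw : btw x m w by apply: (btw_chain lcX cX xmz mwz); rewrite eq_sym.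
have := btw_anti lcX cX xmw (mmax w (conj xwy xwz) xmw) => mw.
by rewrite mw eqxx in wm.
Qed.

(** The point m' lies between m and at least two of x, y, z, while m lies between these two; this
    forces m = m'. *)
Lemma median_unique x y z m m' : median x y z m -> median x y z m' -> m = m'.
Proof.
have H a b p q : btw a p b -> btw a q p -> btw b q p -> btw a q b -> p = q.
  move=> apb aqp bqp aqb; have [apq|bpq] := btw_split q apb.
    exact: (btw_anti lcX cX apq aqp).
  by have := btw_anti lcX cX (btwC bpq) bqp.
move=> [xmy ymz xmz] [xmy' ymz' xmz'].
have two a b : btw a m' b -> btw a m' m \/ btw b m' m.
  by move=> /(btw_split m)[|/btwC]; [left|right].
have [hx|hy] := two _ _ xmy'; have [hx'|hz] := two _ _ xmz'.
- have [hy|hz] := two _ _ ymz'; first exact: (H x y).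
  exact: (H x z).
- exact: (H x z).
- exact: (H x y).
- exact: (H y z).
Qed.

Lemma btw_monotone_cvg a (z : nat -> X) : (forall n, btw a (z n.+1) (z n)) ->
  exists q, z @ \oo --> q /\ forall n, btw a q (z n).
Proof.
move=> zS.
have zmn m n : (m <= n)%N -> btw a (z n) (z m).
  elim: n => [|n IHn]; first by rewrite leqn0 => /eqP->.
  by rewrite leq_eqVlt => /predU1P[->//|/IHn h]; exact: btw_transl h (zS n).
have [q zq] := nat_ultra_cvg z cptX.
have aq n : btw a q (z n).
  apply: btw_cvg (cvg_cst _) zq (cvg_cst _) _ => //.
  by apply: nat_ultra_near; exists n => // m /zmn.
exists q; split => //; apply: contrapT => /(not_cvg_cluster cptX)[q' q'q hq'].
suff : q = q' by move=> qq'; rewrite qq' eqxx in q'q.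
have aq' n : btw a q' (z n).
  apply: contrapT => /(nbtw_open lcX)[E oE [Ea Ez hE]].
  have [k nk /= hk] := hq' _ hE n.
  exact: (hk _ _ Ea Ez (zmn _ _ nk)).
apply: (btw_anti lcX cX (x := a)).
  apply: contrapT => /(nbtw_near lcX) /hq' /(_ 0%N)[n _]; exact.
by apply: btw_cvg (cvg_cst _) (cvg_cst _) zq _ => //; exact: nearW.
Qed.

End Tree.

(** * Dynamics of monotone maps *)

Section Dynamics.
Context {R : realType} {X : metricType R}.
Context (cptX : compact [set: X]) (cX : connected [set: X]).
Context (lcX : locally_connected X) (sepX : separated_points X).
Context (f : X -> X) (cf : continuous f) (mf : monotone_map f).
Implicit Types x y z c w u v : X.

Lemma btw_iter n x (p : X) y : btw x p y -> btw (iter n f x) (iter n f p) (iter n f y).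
Proof. by apply: btw_monotone; exact: monotone_iter. Qed.

Definition asymptotically_periodic x := exists N r c,
  [/\ (0 < N)%N, iter N f c = c & (fun n => iter (r + n * N) f x) @ \oo --> c].

(** * Separation of an orbit by a periodic point *)

Section NotSeparated.
Context (x : X) (apx : ~ asymptotically_periodic x).

Let not_separated_class c N r : (0 < N)%N -> iter N f c = c ->
  exists2 p, (0 < p)%N &
  forall i k, ~ btw (iter (r + i * N) f x) c (iter (r + (i + k * p) * N) f x).
Proof.
move=> N0 fc; pose y n := iter (r + n * N) f x.
have yS t i : y (i + t)%N = iter (t * N) f (y i).
  by rewrite /y -iterD; congr iter; lia.
have shift t i j : btw (y i) c (y j) -> btw (y (i + t)%N) c (y (j + t)%N).
  by rewrite !yS => /(@btw_iter (t * N)%N _ _ _); rewrite (iter_fixed t fc).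
have [u uc hu] : exists2 u, u != c &
    forall B, nbhs u B -> forall K, exists2 n, (K <= n)%N & B (y n).
  apply: not_cvg_cluster => // yc; apply: apx.
  by exists N, r, c; split.
have [V [oV cV Vu VU]] := lcX (nbhs_neq (x := u) (p := c) ltac:(by rewrite eq_sym)).
have VV i j : V (y i) -> V (y j) -> ~ btw (y i) c (y j).
  by move=> Vi Vj /(_ V cV Vi Vj)/VU; exact.
have nV : nbhs u V by exact: open_nbhs_nbhs.
have trans i j k : ~ btw (y i) c (y j) -> ~ btw (y j) c (y k) -> ~ btw (y i) c (y k).
  by move=> h1 h2 /(btw_split (y j))[].
(* Since separation by c persists forward in time, S is closed under
   differences, hence consists of multiples of its least positive element. *)
pose S s := ~ btw (y 0%N) c (y s).
(* Two visits of y to [V] are not separated by c. Since separation persists forward, their time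
   difference belongs to [S]. *)
have SK K : exists2 s, (K <= s)%N & S s.
  have [i _ Vi] := hu V nV 0%N; have [j Kj Vj] := hu V nV (i + K)%N.
  exists (j - i)%N; first by lia.
  move=> /(shift i); rewrite add0n subnK; last by lia.
  exact: VV.
have SB (a b : nat) : (a <= b)%N -> S a -> S b -> S (b - a)%N.
  move=> ab Sa Sb /(shift a); rewrite add0n subnK//.
  by apply: (trans _ 0%N) => // /btwC.
have S0 : exists p, (0 < p)%N && `[< S p >].
  by have [p p0 Sp] := SK 1%N; exists p; rewrite p0; exact/asboolP.
case: (ex_minnP S0) => p /andP[p0 /asboolP Sp] pmin; exists p => //.
have Smul t s : (t * p <= s)%N -> S s -> S (s - t * p)%N.
  elim: t => [|t IHt] ts Ss; first by rewrite mul0n subn0.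
  rewrite mulSn addnC subnDA; apply: SB => //; first by lia.
  by apply: IHt => //; lia.
have Sdvd s : S s -> s = (s %/ p * p)%N.
  move=> Ss; have /Smul := leq_divM s p; move=> /(_ Ss).
  have -> : (s - s %/ p * p = s %% p)%N by rewrite {1}(divn_eq s p) addKn.
  move=> Sm; rewrite {1}(divn_eq s p); have [->|m0] := posnP (s %% p); first by rewrite addn0.
  have : (p <= s %% p)%N by apply: pmin; rewrite m0; exact/asboolP.
  by rewrite leqNgt ltn_mod p0.
have Sp_ t : S (t * p)%N.
  have [s ts Ss] := SK (t * p)%N.
  have -> : (t * p = s - (s %/ p - t) * p)%N.
    rewrite mulnBl -(Sdvd _ Ss); lia.
  by apply: Smul => //; have := Sdvd _ Ss; rewrite mulnBl; lia.
(* A shift by [i * p - i] moves both times to multiples of p, which belong to [S]. *)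
move=> i k; rewrite -/(y i) -/(y _) => /(shift (i * p - i)%N).
have -> : (i + (i * p - i) = i * p)%N by nia.
have -> : (i + k * p + (i * p - i) = (i + k) * p)%N by nia.
by apply: (trans _ 0%N) => [/btwC|]; exact: Sp_.
Qed.

Lemma not_separated c N : (0 < N)%N -> iter N f c = c ->
  exists2 M, (0 < M)%N &
  forall i j, i = j %[mod M] -> ~ btw (iter i f x) c (iter j f x).
Proof.
move=> N0 fc.
have /choice[pf pfP] (r : nat) : exists p, (0 < p)%N /\ forall i k,
    ~ btw (iter (r + i * N) f x) c (iter (r + (i + k * p) * N) f x).
  by have [p p0 hp] := not_separated_class r N0 fc; exists p.
exists (N * \prod_(r < N) pf r)%N.
  by rewrite muln_gt0 N0/= prodn_gt0// => r; have [] := pfP r.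
move=> i j; wlog ij : i j / (i <= j)%N => [hw|] ijM.
  have [ij|/ltnW ji] := leqP i j; first exact: hw.
  by move=> /btwC; exact: hw.
have [t jE] : exists t, j = (i + t * (N * \prod_(r < N) pf r))%N.
  exists ((j - i) %/ (N * \prod_(r < N) pf r))%N.
  rewrite divnK ?subnKC//; rewrite -eqn_mod_dvd//; exact/eqP.
have rN : (i %% N < N)%N by rewrite ltn_mod.
have [P' PE] : exists P', \prod_(r < N) pf r = (P' * pf (i %% N))%N.
  by rewrite (bigD1 (Ordinal rN))//=; eexists; rewrite mulnC.
have := (pfP (i %% N)%N).2 (i %/ N)%N (t * P')%N.
rewrite [in X in X -> _]addnC -divn_eq jE PE.
suff -> : (i %% N + (i %/ N + t * P' * pf (i %% N)) * N =
  i + t * (N * (P' * pf (i %% N))))%N by [].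
by rewrite [X in _ = (X + _)%N](divn_eq i N); lia.
Qed.

End NotSeparated.

(** * Orbits alternating between two points at congruent times *)

Definition alternates x u v := forall M A B, (0 < M)%N -> nbhs u A -> nbhs v B ->
  exists i j k, [/\ (i < j < k)%N, (i = j %[mod M] /\ j = k %[mod M]),
    A (iter i f x), B (iter j f x) & A (iter k f x)].

Section Alternating.
Context (x u v a w : X) (N : nat).
Context (apx : ~ asymptotically_periodic x) (N0 : (0 < N)%N).
Context (fa : iter N f a = a) (alt : alternates x u v).
Context (awu : btw a w u) (wu : w != u) (awv : ~ btw a w v).

Let nearu : nbhs u (fun x' => btw a w x').
Proof. by apply: filterS (btw_open lcX (btwC awu) wu) => ? /btwC. Qed.

Let nearv : nbhs v (fun x' => ~ btw a w x').
Proof. exact: (nbtw_near lcX awv). Qed.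

(** At congruent times the orbit is beyond w near u and not beyond w near v, so w separates the two
    positions, and images of w separate the later ones; a periodic image would contradict
    [not_separated]. *)
Lemma alternating_not_periodic l Q : (0 < Q)%N ->
  iter Q f (iter l f w) = iter l f w -> False.
Proof.
move=> Q0 fQ; have [M M0 hM] := not_separated apx Q0 fQ.
have [i [j [k [_ [ij _] ai aj _]]]] := alt M0 nearu nearv.
have [//|/btwC/(@btw_iter l)] := btw_split (iter j f x) ai.
rewrite -!iterD; apply: hM.
by apply/eqP; rewrite eqn_modDl; exact/eqP.
Qed.

(** Otherwise f^S preserves the set of all z with [btw a w z], contrary to visits near u and then
    near v at times congruent mod [S]. *)
Lemma alternating_not_increasing S : (0 < S)%N -> iter S f a = a ->
  ~ btw a w (iter S f w).
Proof.
move=> S0 fSa aw; have [i [j [k [/andP[ij _] [ijS _] ai aj _]]]] := alt S0 nearu nearv.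
have [t jE] : exists t, j = (t * S + i)%N.
  exists ((j - i) %/ S)%N; rewrite divnK ?subnK//; first exact: ltnW.
  by rewrite -eqn_mod_dvd ?(ltnW ij)//; exact/eqP/esym.
apply: aj; rewrite {}jE iterD; elim: t => [//|t IHt].
rewrite mulSn iterD; have := btw_iter (n := S) IHt; rewrite fSa => h.
exact: btw_transl h aw.
Qed.

(** Take S = k - i for two visits near u. Both w and its image under f^S lie between a and the later
    visit, so one of them is between a and the other. *)
Lemma alternating_return : exists S, [/\ (0 < S)%N, iter S f a = a &
  btw a (iter S f w) w].
Proof.
have [i [j [k [/andP[ij jk] [ijN jkN] ai aj ak]]]] := alt N0 nearu nearv.
have ik : (i < k)%N by exact: ltn_trans jk.
have fSa : iter (k - i) f a = a.
  rewrite -(@divnK N (k - i)); first exact: iter_fixed.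
  by rewrite -eqn_mod_dvd ?(ltnW ik)// ijN; exact/eqP/esym.
exists (k - i)%N; split => //; first by rewrite subn_gt0.
have := btw_iter (n := (k - i)%N) ai; rewrite fSa -iterD subnK ?(ltnW ik)// => ak'.
have [/alternating_not_increasing|//] := btw_total lcX cX ak ak'.
by case => //; rewrite subn_gt0.
Qed.

End Alternating.

(* With v replaced by a cluster point a itself, w moves towards a under G = f^S.
   A later visit x_j closer to a than G w then has G w between x_j and w, which
   G^n turns into a contradiction when x_k = G^n x_j is beyond w again. *)
Lemma no_periodic_cluster x N r a : ~ asymptotically_periodic x -> (0 < N)%N ->
  iter N f a = a ->
  ~ (forall B, nbhs a B -> forall K, exists2 n, (K <= n)%N & B (iter (r + n * N) f x)).
Proof.
move=> apx N0 fa ha; pose y n := iter (r + n * N) f x.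
have yS t i : y (i + t)%N = iter (t * N) f (y i).
  by rewrite /y -iterD; congr iter; lia.
have [u ua hu] : exists2 u, u != a &
    forall B, nbhs u B -> forall K, exists2 n, (K <= n)%N & B (y n).
  apply: not_cvg_cluster => // yc; apply: apx.
  by exists N, r, a; split.
have alt : alternates x u a.
  move=> M A B M0 uA aB.
  have [rho hrho] := pigeonhole_mod (P := A \o y) id M0 (hu A uA).
  (* Near a the next [M] steps of f^N stay in [B], because a is fixed; a visit can thus be delayed
     by t steps into the residue class [rho]. *)
  have /ha haM : nbhs a (fun z => forall t, (t < M)%N -> B (iter (t * N) f z)).
    apply: near_all_lt => t; apply: (continuous_iter (n := (t * N)%N) cf).
    by rewrite iter_fixed.
  have [i [_ Ai iM]] := hrho 0%N.
  have [j0 ij0 Bj] := haM i.+1.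
  pose t := ((rho + (M - j0 %% M)) %% M)%N.
  have tM : (t < M)%N by rewrite ltn_mod.
  have [k [jk Ak kM]] := hrho (j0 + t).+1.
  have jM : ((j0 + t) %% M = rho)%N.
    have rhoM : (rho < M)%N by rewrite -iM ltn_mod.
    have j0M : (j0 %% M < M)%N by rewrite ltn_mod.
    rewrite /t modnDmr.
    have -> : (j0 + (rho + (M - j0 %% M)) = (j0 %/ M).+1 * M + rho)%N.
      by rewrite {1}(divn_eq j0 M) mulSn; lia.
    by rewrite modnMDl modn_small.
  exists (r + i * N)%N, (r + (j0 + t) * N)%N, (r + k * N)%N; split => //.
  - by apply/andP; split; nia.
  - have modM m1 m2 : m1 = m2 %[mod M] -> (r + m1 * N = r + m2 * N %[mod M])%N.
      by move=> m12; apply/eqP; rewrite eqn_modDl -modnMml m12 modnMml.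
    by split; apply: modM; rewrite ?iM ?jM ?kM.
  - by rewrite -/(y _) yS; exact: Bj.
have [w [wa wu awu]] := sepX (u := a) (v := u) ltac:(by rewrite eq_sym).
have awa : ~ btw a w a by move=> /btwxx wa'; rewrite wa' eqxx in wa.
have notper := alternating_not_periodic apx alt awu wu awa.
have [S [S0 fSa aSw]] := alternating_return N0 fa alt awu wu awa.
have Swa : iter S f w <> a by move=> Swa; apply: (notper S N N0); rewrite Swa.
have aSa : ~ btw a (iter S f w) a by move=> /btwxx.
have [_ [j [k [/andP[_ jk] [_ jkS] _ aj ak]]]] :=
  alt S _ _ S0 (btw_open lcX (btwC awu) wu) (nbtw_near lcX aSa).
have [n kE] : exists n, k = (n * S + j)%N.
  exists ((k - j) %/ S)%N; rewrite divnK ?subnK//; first exact: ltnW.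
  by rewrite -eqn_mod_dvd ?(ltnW jk)//; exact/eqP/esym.
have jSw : btw (iter j f x) (iter S f w) w by have [|] := btw_split (iter j f x) aSw.
have fna : iter (n * S) f a = a by exact: iter_fixed.
have := btw_iter (n := (n * S)%N) jSw; rewrite -!iterD -kE => h1.
have := btw_iter (n := (n * S)%N) aSw; rewrite fna -!iterD => h2.
have h3 : btw a (iter (n * S) f w) (iter k f x).
  apply: btw_transl (btwC ak) _; elim: (n) => [//|m IHm].
  rewrite mulSn addnC iterD; apply: btw_transl IHm _.
  by have := btw_iter (n := (m * S)%N) aSw; rewrite iter_fixed.
(* [h1] and [h2] place the image of w under f^(nS+S) on both sides of its image under f^(nS), which
   lies between a and the visit at time k; hence the two images coincide. *)
have h4 : iter (n * S + S) f w = iter (n * S) f w.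
  have [h5|h5] := btw_split (iter (n * S + S) f w) h3.
    exact: (btw_anti lcX cX h2 h5).
  exact: (btw_anti lcX cX h1 (btwC h5)).
by apply: (notper (n * S)%N S S0); rewrite -iterD addnC.
Qed.

Lemma asymptotically_periodic_eap x :
  asymptotically_periodic x -> eventually_almost_periodic f x.
Proof.
move=> [N [r [c [N0 fc yc]]]] e e0; have e2 : 0 < e / 2 by rewrite divr_gt0.
have /yc[K0 _ hK] : nbhs c (fun z => forall t, (t < N)%N ->
    ball (iter t f c) (e / 2) (iter t f z)).
  apply: near_all_lt => t; apply: (continuous_iter (n := t) cf).
  exact: nbhsx_ballx.
exists N, (r + K0 * N)%N; split => // i j Ki Kj ij.
have H n : (r + K0 * N <= n)%N ->
    mdist (iter ((n - r) %% N) f c) (iter n f x) < e / 2.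
  move=> Kn; have K0n : (K0 <= (n - r) %/ N)%N by rewrite leq_divRL//; lia.
  have := hK _ K0n ((n - r) %% N)%N; rewrite ltn_mod => /(_ N0).
  rewrite ballEmdist/= -iterD.
  by have -> : ((n - r) %% N + (r + (n - r) %/ N * N) = n)%N
    by have := divn_eq (n - r) N; lia.
have ijN : ((i - r) %% N = (j - r) %% N)%N.
  by apply/eqP; rewrite -(eqn_modDr r) !subnK ?(leq_trans (leq_addr _ _) Ki)
    ?(leq_trans (leq_addr _ _) Kj)//; exact/eqP.
have := H i Ki; rewrite ijN => h1; have h2 := H j Kj.
have := metric_triangle (iter i f x) (iter ((j - r) %% N) f c) (iter j f x).
rewrite (metric_sym _ (iter _ f c)); lra.
Qed.

(** Every positive [M] divides m! for m at least [M], so a congruence mod m! is one mod [M].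
    Pigeonhole puts infinitely many pairs of times in one residue class. *)
Lemma alternates_ultra x (i_ j_ : nat -> nat) u v :
  (forall m, (m <= i_ m)%N) -> (forall m, (m <= j_ m)%N) ->
  (forall m, i_ m = j_ m %[mod m`!]) ->
  (fun m => iter (i_ m) f x) @ nat_ultra --> u ->
  (fun m => iter (j_ m) f x) @ nat_ultra --> v -> alternates x u v.
Proof.
move=> im jm ijm iu jv M A B M0 uA vB.
pose P m := [/\ (M <= m)%N, A (iter (i_ m) f x) & B (iter (j_ m) f x)].
have UP : nat_ultra P.
  have UM : nat_ultra [set m | (M <= m)%N] by apply: nat_ultra_near; exists M.
  by apply: filterS (filterI UM (filterI (cvg_preimage iu uA) (cvg_preimage jv vB)))
    => m [Mm [Am Bm]].
have [rho hrho] := pigeonhole_mod (P := P) i_ M0 (fun K => nat_ultra_ex K UP).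
have mM m : (M <= m)%N -> i_ m = j_ m %[mod M].
  move=> Mm; have MF : (M %| m`!)%N by rewrite dvdn_fact// M0.
  by rewrite -(modn_dvdm _ MF) ijm modn_dvdm.
have [m1 [_ [Mm1 A1 _] r1]] := hrho 0%N.
have [m2 [m12 [Mm2 _ B2] r2]] := hrho (i_ m1).+1.
have [m3 [m23 [Mm3 A3 _] r3]] := hrho (j_ m2).+1.
exists (i_ m1), (j_ m2), (i_ m3); split => //.
  by rewrite (leq_trans m12 (jm _)) (leq_trans m23 (im _)).
by rewrite -(mM _ Mm2) r1 r2 r3.
Qed.

(** The images of w under powers of f^S converge to a periodic q, which lies between limits of the
    positions at times i + nS and j + nS, for congruent i and j. As q is no cluster point, it
    differs from both and separates these positions for some n, contrary to [not_separated]. *)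
Lemma no_separated_alternation x u v a w : ~ asymptotically_periodic x ->
  alternates x u v -> f a = a -> btw u w v -> w != u -> w != v ->
  btw a w u -> False.
Proof.
move=> apx alt fa uwv wu wv awu.
(* If w lies between a and v as well, it is replaced by a point between w and u. *)
wlog awv : w uwv wu wv awu / ~ btw a w v.
  move=> H; have [awv|awv] := pselect (btw a w v); last exact: (H w).
  have [w' [w'w w'u ww'u]] := sepX wu.
  apply: (H w') => //.
  - exact: (btwC (btw_transr (btwC uwv) ww'u)).
  - apply/eqP => w'v; rewrite w'v in w'w ww'u.
    by have := btw_anti lcX cX uwv (btwC ww'u) => e; rewrite e eqxx in w'w.
  - exact: btw_transr awu ww'u.
  - have aww' : btw a w w' by apply: (btw_chain lcX cX awu ww'u); rewrite eq_sym.
    move=> /(btw_split w)[aw'w|ww'v].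
      by have := btw_anti lcX cX aww' aw'w => e; rewrite e eqxx in w'w.
    have w'wv := btw_between lcX cX uwv (btwC ww'u).
    by have := btw_anti lcX cX (btwC ww'v) (btwC w'wv) => e; rewrite e eqxx in w'w.
have [S [S0 fSa aSw]] := alternating_return (N := 1%N) isT fa alt awu wu awv.
pose z n := iter (n * S) f w.
have [q [zq aq]] : exists q, z @ \oo --> q /\ forall n, btw a q (z n).
  apply: btw_monotone_cvg => // n.
  have := btw_iter (n := (n * S)%N) aSw; rewrite iter_fixed// -iterD.
  by rewrite /z mulSn addnC.
have fq : iter S f q = q.
  have h1 : (fun n => z n.+1) @ \oo --> iter S f q.
    have -> : (fun n => z n.+1) = iter S f \o z.
      by apply/funext => n; rewrite /z /= mulSn iterD.
    by apply: continuous_cvg zq; exact: (continuous_iter (n := S) cf).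
  have h2 : (fun n => z n.+1) @ \oo --> q.
    by move=> B /zq[K _ hK]; exists K => // n /= Kn; apply: hK; exact: leqW.
  exact: (cvg_unique (@metric_hausdorff R X) h1 h2).
have [M M0 hM] := not_separated apx S0 fq.
have nearu : nbhs u (fun x' => btw a w x').
  by apply: filterS (btw_open lcX (btwC awu) wu) => ? /btwC.
have [i [j [_ [_ [ij _] ai aj _]]]] := alt M _ _ M0 nearu (nbtw_near lcX awv).
have iwj : btw (iter i f x) w (iter j f x).
  by have [//|/btwC] := btw_split (iter j f x) ai.
have [al ialp] := nat_ultra_cvg (fun n => iter (n * S) f (iter i f x)) cptX.
have [be jbe] := nat_ultra_cvg (fun n => iter (n * S) f (iter j f x)) cptX.
have zqU : z @ nat_ultra --> q by move=> B /zq h; apply: nat_ultra_near; exact: h.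
have aqb : btw al q be.
  apply: (btw_cvg lcX _ ialp zqU jbe).
  by apply: nearW => n; exact: btw_iter.
have noq (l : nat) : (fun n => iter (n * S) f (iter l f x)) @ nat_ultra --> q -> False.
  move=> lq; apply: (@no_periodic_cluster x S l q apx S0 fq) => B /lq UB K.
  have [n Kn Bn] := nat_ultra_ex K UB; exists n => //.
  by rewrite addnC iterD.
have qa : q != al by apply/eqP => qa; rewrite -qa in ialp; exact: noq ialp.
have qb : q != be by apply/eqP => qb; rewrite -qb in jbe; exact: noq jbe.
have [A [B [alA beB AB]]] := btw_open2 lcX aqb qa qb.
have [n [An Bn]] := filter_ex (filterI (cvg_preimage ialp alA) (cvg_preimage jbe beB)).
have := AB _ _ An Bn; rewrite -!iterD; apply: hM.
by apply/eqP; rewrite eqn_modDl; exact/eqP.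
Qed.

(** A failure yields pairs of times, congruent mod m!, whose positions have distinct limits u and v.
    A point w separating these lies between the fixed point a and one of them, and the situation is
    symmetric in u and v. *)
Lemma monotone_eap x : eventually_almost_periodic f x.
Proof.
have [/asymptotically_periodic_eap//|apx] := pselect (asymptotically_periodic x).
apply: contrapT => /existsNP[e /not_implyP[e0 he]].
have /choice[ij ijP] (m : nat) : exists ij : nat * nat,
    [/\ (m <= ij.1)%N, (m <= ij.2)%N, ij.1 = ij.2 %[mod m`!] &
      e <= mdist (iter ij.1 f x) (iter ij.2 f x)].
  apply: contrapT => /forallNP h; apply: he; exists m`!, m; split; first exact: fact_gt0.
  move=> i j mi mj ijm; rewrite ltNge; apply/negP => eij.
  by apply: (h (i, j)); split.
have [u iu] := nat_ultra_cvg (fun m => iter (ij m).1 f x) cptX.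
have [v jv] := nat_ultra_cvg (fun m => iter (ij m).2 f x) cptX.
have uv : u != v.
  apply/eqP => uv; rewrite -uv in jv; have e2 : 0 < e / 2 by rewrite divr_gt0.
  have [m [/= im jm]] := filter_ex (filterI (cvg_preimage iu (nbhsx_ballx u _ e2))
    (cvg_preimage jv (nbhsx_ballx u _ e2))).
  have [_ _ _] := ijP m; apply/negP; rewrite -ltNge.
  move: im jm; rewrite !ballEmdist/= => im jm.
  have := metric_triangle (iter (ij m).1 f x) u (iter (ij m).2 f x).
  rewrite (metric_sym _ u); lra.
have alt1 : alternates x u v.
  by apply: alternates_ultra iu jv => m; have [] := ijP m.
have alt2 : alternates x v u.
  by apply: alternates_ultra jv iu => m; have [] := ijP m.
have [a _ fa] : exists2 a, [set: X] a & f a = a.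
  by apply: convex_fixed_point => //; exists x.
have [w [wu wv uwv]] := sepX uv.
have [uwa|awv] := btw_split a uwv.
  exact: (no_separated_alternation apx alt1 fa uwv wu wv (btwC uwa)).
exact: (no_separated_alternation apx alt2 fa (btwC uwv) wv wu awv).
Qed.

(** For y late in the orbit and g = f^N, the arcs from y to all points g^n(y) form a small convex
    invariant set [L]; g has a fixed point in its closure. *)
Lemma periodic_near x (e : R) : 0 < e -> exists K, forall k, (K <= k)%N ->
  exists2 c, periodic_points f c & mdist c (iter k f x) < e.
Proof.
move=> e0; have e2 : 0 < e / 2 by rewrite divr_gt0.
have [d d0 hd] := uniformly_locally_connected cptX lcX e2.
have [N [K [N0 hK]]] := monotone_eap x d0.
exists K => k Kk; set y := iter k f x; pose g := iter N f.
have gy n : mdist y (iter n g y) < d.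
  rewrite /y /g -iterM -iterD; apply: hK => //; last by rewrite modnMDl.
  exact: leq_trans Kk (leq_addl _ _).
pose L := \bigcup_n [set p | btw y p (iter n g y)].
have Lball : L `<=` ball y (e / 2).
  move=> p [n _ /= yp]; have [C [cC Cy Cg]] := hd _ _ (gy n).
  by apply; exact: yp.
have Ly : L y by exists 0%N.
have convL p q : L p -> L q -> forall z, btw p z q -> L z.
  move=> [n _ yp] [m _ yq] z /(btw_split y)[|] yz.
    by exists n => //; exact: btw_transl yp (btwC yz).
  by exists m => //; exact: btw_transl yq yz.
have gL : g @` L `<=` L.
  move=> _ [p [n _ /= yp] <-].
  have /(btw_split y)[ygp|ygp] : btw (g y) (g p) (iter n.+1 g y).
    by rewrite iterS; exact: btw_iter.
    by exists 1%N => //; exact: btwC.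
  by exists n.+1.
have cg : continuous g by exact: continuous_iter.
have [c clc gc] : exists2 c, closure L c & g c = c.
  apply: (convex_fixed_point cptX cX lcX sepX) => //.
  - exact: closed_closure.
  - by exists y; exact: subset_closure.
  - move=> p q z clp clq pzq.
    have [->//|zp] := eqVneq z p; have [->//|zq] := eqVneq z q.
    have [A [B [pA qB AB]]] := btw_open2 lcX pzq zp zq.
    have [p' [Lp' Ap']] := clp _ pA; have [q' [Lq' Bq']] := clq _ qB.
    by apply: subset_closure; apply: (convL p' q') => //; exact: AB.
  - move=> _ [p clp <-] B /cg /clp[q [Lq Bq]].
    by exists (g q); split => //; apply: gL; exists q.
exists c; first by exists N.
have [z [/Lball]] := clc _ (nbhsx_ballx c _ e2).
rewrite !ballEmdist/= => yz cz.
have := metric_triangle c z y; rewrite (metric_sym z); lra.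
Qed.

(** If z is not regularly recurrent, it is not between periodic points near it, and iterates fixing
    p and a point m close to z carry z beyond m and far from z. Some such iterate h pushes periodic
    points q near z away from p, while q, being periodic, returns to itself under h. *)
Lemma closure_periodic_rr z : closure (periodic_points f) z -> regularly_recurrent f z.
Proof.
move=> clz e e0; apply: contrapT => hN.
have {}hN N : (0 < N)%N -> exists2 k, (0 < k)%N & e <= mdist z (iter (k * N) f z).
  move=> N0; apply: contrapT => h; apply: hN; exists N => // k k0.
  by rewrite ltNge; apply/negP => ?; apply: h; exists k.
have [U [oU cU Uz Ue]] := lcX (nbhsx_ballx z e e0).
have nU : nbhs z U by exact: open_nbhs_nbhs.
have notbtw p q : periodic_points f p -> periodic_points f q -> U p -> U q ->
    ~ btw p z q.
  move=> [N N0 fp] [M M0 fq] Up Uq pzq.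
  have [|k k0] := hN (N * M)%N; first by rewrite muln_gt0 N0.
  have := btw_iter (n := (k * (N * M))%N) pzq.
  rewrite {1}[(N * M)%N]mulnC !mulnA (iter_fixed _ fp) (iter_fixed _ fq) -mulnA.
  move=> /(_ U cU Up Uq)/Ue; rewrite ballEmdist/= => h.
  by rewrite leNgt h.
have [p [pP Up]] := clz _ nU.
have zp : z != p by apply/eqP => zp; apply: (notbtw p p) => //; rewrite -zp.
(* the medians of p, z and periodic points close to z are periodic *)
have trunk V : nbhs z V -> exists m, [/\ periodic_points f m, V m, btw p m z & m != z].
  move=> nV; have [W [oW cW Wz WVU]] := lcX (filterI nV nU).
  have [q [qP Wq]] := clz _ (open_nbhs_nbhs (conj oW Wz)).
  have [m [pmq qmz pmz]] := median_exists cptX cX lcX sepX p q z.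
  have Wm : W m by exact: qmz.
  have mz : m != z.
    apply/eqP => mz; apply: (notbtw p q) => //; last by rewrite -mz.
    by have [] := WVU _ Wq.
  exists m; split => //; last by have [] := WVU _ Wm.
  (* For r close to z, m is also the median of the periodic points p, q, r, hence fixed by a common
     period. *)
  have near_z : nbhs z (fun r => btw p m r /\ btw q m r).
    by apply: filterI; [apply: filterS (btw_open lcX (btwC pmz) mz) |
      apply: filterS (btw_open lcX (btwC qmz) mz)] => ? /btwC.
  have [r [[M M0 fr] [pmr qmr]]] := clz _ near_z.
  have [N N0 fp] := pP; have [L L0 fq] := qP.
  exists (N * L * M)%N; first by rewrite !muln_gt0 N0 L0 M0.
  have fp' : iter (N * L * M) f p = p by rewrite -mulnA mulnC iter_fixed.
  have fq' : iter (N * L * M) f q = q by rewrite mulnAC iter_fixed.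
  have fr' : iter (N * L * M) f r = r by exact: iter_fixed.
  apply: (median_unique cX lcX (x := p) (y := q) (z := r)); last by split.
  have h1 := btw_iter (n := (N * L * M)%N) pmq.
  have h2 := btw_iter (n := (N * L * M)%N) pmr.
  have h3 := btw_iter (n := (N * L * M)%N) qmr.
  by rewrite fp' fq' fr' in h1 h2 h3; split.
have [P0 P00 fp] := pP.
have /choice[hk hkP] (n : nat) : exists mN : X * nat, [/\ ball z n.+1%:R^-1 mN.1,
    btw p mN.1 (iter mN.2 f z), iter mN.2 f p = p & e <= mdist z (iter mN.2 f z)].
  have n0 : 0 < n.+1%:R^-1 :> R by rewrite invr_gt0.
  have [m [[M M0 fm] Bm pmz mz]] := trunk _ (nbhsx_ballx z _ n0).
  have [|k k0 hk] := hN (P0 * M)%N; first by rewrite muln_gt0 P00.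
  exists (m, (k * (P0 * M))%N) => /=.
  have fp' : iter (k * (P0 * M)) f p = p by rewrite mulnCA mulnC iter_fixed.
  have fm' : iter (k * (P0 * M)) f m = m by rewrite mulnA iter_fixed.
  split => //; have := btw_iter (n := (k * (P0 * M))%N) pmz.
  by rewrite fp' fm'.
have [ze hze] := nat_ultra_cvg (fun n => iter (hk n).2 f z) cptX.
have mcvg : (fun n => (hk n).1) @ nat_ultra --> z.
  apply/cvg_ballP => d d0; apply: nat_ultra_near.
  near=> n; have [+ _ _ _] := hkP n; apply: le_ball; apply: ltW.
  by near: n; exact: near_infty_natSinv_lt (PosNum d0).
have pzze : btw p z ze.
  have pcvg : (fun=> p) @ nat_ultra --> p by exact: cvg_cst.
  apply: (btw_cvg lcX _ pcvg mcvg hze).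
  by apply: nearW => n; have [] := hkP n.
have zze : z != ze.
  apply/eqP => zze; have /= /(nat_ultra_ex 0)[n _] := cvg_preimage hze (nbhsx_ballx ze _ e0).
  have [_ _ _] := hkP n; rewrite -zze /= ballEmdist/= leNgt => /negP; exact.
have [w [wz wze zwze]] := sepX zze.
have : nbhs ze ((fun x => btw z w x) `&` ~` [set w]).
  by apply: filterI; [apply: filterS (btw_open lcX (btwC zwze) wze) => ? /btwC | exact: nbhs_neq].
move=> /(cvg_preimage hze)/(nat_ultra_ex 0)[n _ [/= zwh /eqP hw]].
have [_ _ fp' _] := hkP n; set h := iter (hk n).2 f in zwh hw fp'.
rewrite eq_sym in hw.
have [A [B [zA hB AB]]] := btw_open2 lcX zwh wz hw.
have ch : continuous h by exact: continuous_iter.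
have : nbhs z (A `&` h @^-1` B `&` ~` [set w]).
  by apply: filterI; [apply: filterI => //; exact: ch|exact: nbhs_neq].
move=> /trunk[q [[Q Q0 fq] [[Aq Bq] qw] pqz qz]].
have qwhq : btw q w (h q) by exact: AB.
have pzw : btw p z w by apply: (btw_chain lcX cX pzze zwze); rewrite eq_sym.
have pqw : btw p q w by exact: btw_transl pzw pqz.
have pqhq : btw p q (h q).
  have [//|hqw] := btw_split (h q) pqw.
  by case: qw; exact: (btw_anti lcX cX hqw (btwC qwhq)).
(* The iterates of q under h stay beyond [h q] as seen from p; the return of q to itself then puts
   [h q] between p and q. *)
have phq j : btw p (h q) (iter j.+1 h q).
  elim: j => [//|j IHj]; apply: (btw_transl _ IHj).
  have := btw_iter (n := (j.+1 * (hk n).2)%N) pqhq.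
  by rewrite iter_fixed// !iterM -/h -iterSr.
have hqq : h q = q.
  apply: (btw_anti lcX cX (x := p)) => //.
  by have := phq Q.-1; rewrite prednK// -iterM mulnC iter_fixed.
by apply: qw; move: qwhq; rewrite hqq => /btwxx.
Unshelve. all: by end_near.
Qed.

End Dynamics.

(** * Hyperspaces of finite sets *)

Section OmegaLimits.
Context {R : realType} {Y : metricType R} (F : Y -> Y) (cF : continuous F).
Implicit Types x y z : Y.

Lemma omega_limitP y z : omega_limit F y z <->
  forall B, nbhs z B -> forall K, exists2 k, (K <= k)%N & B (iter k F y).
Proof.
split=> [yz B zB K|yz m m0 B zB].
  have [_ [[k /= Kk <-] Bk]] := yz K.+1 isT B zB.
  by exists k => //; exact: ltnW.
have [k mk Bk] := yz B zB m; exists (iter k F y); split => //; by exists k.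
Qed.

Lemma regularly_recurrent_omega y : regularly_recurrent F y -> omega_limit F y y.
Proof.
move=> yrr; apply/omega_limitP => B /nbhs_ballP[e /= e0 eB] K.
have [N N0 hN] := yrr e e0; exists (K.+1 * N)%N; first by nia.
by apply: eB; rewrite ballEmdist; exact: hN.
Qed.

Lemma eap_regularly_recurrent y z : eventually_almost_periodic F y ->
  omega_limit F y z -> regularly_recurrent F z.
Proof.
move=> yap /omega_limitP yz e e0; have e3 : 0 < e / 3 by rewrite divr_gt0.
have [N [K [N0 hK]]] := yap _ e3; exists N => // k k0.
have : nbhs z (ball z (e / 3) `&`
    iter (k * N) F @^-1` ball (iter (k * N) F z) (e / 3)).
  apply: filterI; first exact: nbhsx_ballx.
  by apply: (continuous_iter (n := (k * N)%N) cF); exact: nbhsx_ballx.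
move=> /yz /(_ K)[m Km]; rewrite !ballEmdist/= -iterD => -[zm kzm].
have := hK m (k * N + m)%N Km (leq_trans Km (leq_addl _ _)).
rewrite modnMDl => /(_ erefl) h.
have := metric_triangle z (iter m F y) (iter (k * N) F z).
have := metric_triangle (iter m F y) (iter (k * N + m) F y) (iter (k * N) F z).
rewrite (metric_sym (iter (k * N + m) F y)); lra.
Qed.

Lemma omega_invariant y : F @` omega_limit F y `<=` omega_limit F y.
Proof.
move=> _ [z /omega_limitP yz <-]; apply/omega_limitP => B /cF /yz h K.
by have [k Kk Bk] := h K; exists k.+1 => //; exact: leqW.
Qed.

(** Let z be in a closed invariant subset of the limit set. The orbit of y comes so close to z that
    it follows the orbit of z for [N] steps, and up to e / 3 it repeats these positions with period
    [N]; so the orbit of z comes close to every limit point w. *)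
Lemma eap_minimal y : eventually_almost_periodic F y ->
  omega_limit F y !=set0 -> minimal_set F (omega_limit F y).
Proof.
move=> yap y0; split.
  split => //; last exact: omega_invariant.
  by apply: closed_bigI => m _; exact: closed_closure.
move=> M [[z Mz] clM FM] Mom; apply/seteqP; split => // w /omega_limitP yw.
have MF k : M (iter k F z) by elim: k => //= k IHk; apply: FM; exists (iter k F z).
apply: clM => B /nbhs_ballP[e /= e0 eB]; have e3 : 0 < e / 3 by rewrite divr_gt0.
have [N [K [N0 hK]]] := yap _ e3.
have /omega_limitP yz := Mom _ Mz.
have nz : nbhs z (fun x => forall q, (q < N)%N -> ball (iter q F z) (e / 3) (iter q F x)).
  apply: near_all_lt => q; apply: (continuous_iter (n := q) cF).
  exact: nbhsx_ballx.
have [m Km hm] := yz _ nz K.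
have [p mp] := yw _ (nbhsx_ballx w _ e3) m; rewrite ballEmdist/= => wp.
exists (iter ((p - m) %% N) F z); split => //; apply: eB.
have := hm ((p - m) %% N)%N; rewrite ltn_mod => /(_ N0).
rewrite !ballEmdist/= -iterD => h1.
have := hK p ((p - m) %% N + m)%N (leq_trans Km mp) (leq_trans Km (leq_addl _ _)).
rewrite modnDml subnK// => /(_ erefl) h2.
have := metric_triangle w (iter p F y) (iter ((p - m) %% N) F z).
have := metric_triangle (iter p F y) (iter ((p - m) %% N + m) F y) (iter ((p - m) %% N) F z).
rewrite (metric_sym (iter ((p - m) %% N + m) F y)); lra.
Qed.

End OmegaLimits.

Lemma filter_finite (S T : Type) (F : set_system T) (A : set S) (P : S -> set T) :
  Filter F -> finite_set A -> (forall a, A a -> F (P a)) ->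
  F (fun k => forall a, A a -> P a k).
Proof.
elim/Pchoice: S => S in A P *; move=> FF /finite_fsetP[D ->] FP.
exact: (filter_bigI (D := D)).
Qed.

(** Pointwise data become uniform on a finite set: the product of the moduli and the maximum of the
    thresholds serve all points. *)
Lemma finite_common_multiple (T : Type) (A : set T) (Q : T -> nat -> nat -> Prop) :
  finite_set A ->
  (forall x N K N' K', (N %| N')%N -> (K <= K')%N -> Q x N K -> Q x N' K') ->
  (forall x, A x -> exists N K, (0 < N)%N /\ Q x N K) ->
  exists N K, (0 < N)%N /\ forall x, A x -> Q x N K.
Proof.
elim/Pchoice: T => T in A Q *.
move=> /finite_seqP[s ->] Qmon; elim: s => [|a s IHs] Qs; first by exists 1%N, 0%N.
have [|N [K [N0 hs]]] := IHs; first by move=> x xs; apply: Qs; rewrite /= inE xs orbT.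
have [|M [L [M0 ha]]] := Qs a; first by rewrite /= inE eqxx.
exists (N * M)%N, (maxn K L); split; first by rewrite muln_gt0 N0.
move=> x; rewrite /= inE => /predU1P[->|xs].
  by apply: Qmon ha; rewrite ?leq_maxr ?dvdn_mull.
by apply: Qmon (hs x xs); rewrite ?leq_maxl ?dvdn_mulr.
Qed.

Section Hyperspace.
Context {R : realType} {X : metricType R} (n : nat).
Implicit Types (f : X -> X) (A B : finite_hyperspace X n).

Lemma fhs_dist_le A B (e : R) : 0 < e ->
  (forall a, fhs_set A a -> exists2 b, fhs_set B b & mdist a b < e) ->
  (forall b, fhs_set B b -> exists2 a, fhs_set A a & mdist a b < e) ->
  mdist A B <= e.
Proof.
move=> e0 AB BA; apply: (ge_inf (hausdorff_dist_has_lbound A B)); split => //.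
  by move=> a /AB[b Bb ab]; exists b => //; rewrite ballEmdist/= metric_sym.
by move=> b /BA[a Aa ab]; exists a => //; rewrite ballEmdist.
Qed.

Lemma fhs_dist_lt A B (e : R) : mdist A B < e ->
  (forall a, fhs_set A a -> exists2 b, fhs_set B b & mdist a b < e) /\
  (forall b, fhs_set B b -> exists2 a, fhs_set A a & mdist a b < e).
Proof.
move=> /fhs_dist_ltP[d de [d0 AB BA]]; split.
  move=> a /AB[b Bb]; rewrite ballEmdist/= metric_sym => ab.
  by exists b => //; exact: lt_trans de.
move=> b /BA[a Aa]; rewrite ballEmdist/= => ab.
by exists a => //; exact: lt_trans de.
Qed.

Lemma iter_fhs_map f k A : iter k (fhs_map f n) A = fhs_map (iter k f) n A.
Proof.
apply: fhs_inj; elim: k => [|k IHk] /=; first by rewrite image_id.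
by rewrite IHk image_comp.
Qed.

Lemma continuous_fhs_map f : continuous f -> continuous (fhs_map f n).
Proof.
move=> cf A V /nbhs_ballP[e /= e0 eV]; have e2 : 0 < e / 2 by rewrite divr_gt0.
pose Q (x : X) (N K : nat) := forall y, mdist x y < K.+1%:R^-1 -> mdist (f x) (f y) < e / 2.
have [||N [K [N0 hQ]]] := @finite_common_multiple X A Q (fhs_finite A).
- move=> x N K N' K' _ KK' h y xy; apply: h; apply: lt_le_trans xy _.
  by rewrite lef_pV2 ?posrE// ler_nat.
- move=> x _; have /nbhs_ballP[d /= d0 hd] := cf x _ (nbhsx_ballx (f x) _ e2).
  have [K _ /(_ K (leqnn K))/= hK] := near_infty_natSinv_lt (PosNum d0).
  exists 1%N, K; split => // y xy; have := hd y; rewrite /= !ballEmdist/=.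
  by apply; exact: lt_trans hK.
have K0 : 0 < K.+1%:R^-1 :> R by rewrite invr_gt0.
apply: filterS (nbhsx_ballx A _ K0) => B; rewrite ballEmdist/= => /fhs_dist_lt[AB BA].
apply: eV; rewrite ballEmdist/=; apply: (@le_lt_trans _ _ (e / 2)); last by lra.
apply: fhs_dist_le => // [_ [a Aa <-]|_ [b Bb <-]].
  by have [b Bb ab] := AB a Aa; exists (f b); [exists b|exact: hQ].
by have [a Aa ab] := BA b Bb; exists (f a); [exists a|exact: hQ].
Qed.

Lemma fhs_eap f A : (forall a, fhs_set A a -> eventually_almost_periodic f a) ->
  eventually_almost_periodic (fhs_map f n) A.
Proof.
move=> ap e e0; have e2 : 0 < e / 2 by rewrite divr_gt0.
pose Q (x : X) N K := forall i j, (K <= i)%N -> (K <= j)%N -> i = j %[mod N] ->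
  mdist (iter i f x) (iter j f x) < e / 2.
have [||N [K [N0 hQ]]] := @finite_common_multiple X A Q (fhs_finite A).
- move=> x N K N' K' NN' KK' h i j Ki Kj ij; apply: h.
  + exact: leq_trans Ki.
  + exact: leq_trans Kj.
  + by rewrite -(modn_dvdm _ NN') ij modn_dvdm.
- by move=> x /ap/(_ _ e2)[N [K [N0 h]]]; exists N, K.
exists N, K; split => // i j Ki Kj ij; rewrite !iter_fhs_map.
apply: (@le_lt_trans _ _ (e / 2)); last by lra.
apply: fhs_dist_le => // [_ [a Aa <-]|_ [a Aa <-]].
  by exists (iter j f a); [exists a|exact: hQ].
by exists (iter i f a); [exists a|exact: hQ].
Qed.

Lemma fhs_regularly_recurrent f A :
  (forall a, fhs_set A a -> regularly_recurrent f a) ->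
  regularly_recurrent (fhs_map f n) A.
Proof.
move=> rr e e0; have e2 : 0 < e / 2 by rewrite divr_gt0.
pose Q (x : X) N (K : nat) := forall k, (0 < k)%N -> (N %| k)%N -> mdist x (iter k f x) < e / 2.
have [||N [K0 [N0 hQ]]] := @finite_common_multiple X A Q (fhs_finite A).
- by move=> x N K N' K' NN' KK' h k k0 Nk; apply: h => //; exact: dvdn_trans Nk.
- move=> x /rr/(_ _ e2)[N N0 h]; exists N, 0%N; split => // k k0 Nk.
  by rewrite -(divnK Nk); apply: h; rewrite divn_gt0// dvdn_leq.
exists N => // k k0; rewrite iter_fhs_map.
have kN : (0 < k * N)%N by rewrite muln_gt0 k0.
have NkN : (N %| k * N)%N by exact: dvdn_mull.
apply: (@le_lt_trans _ _ (e / 2)); last by lra.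
apply: fhs_dist_le => // [a Aa|_ [a Aa <-]].
  by exists (iter (k * N) f a); [exists a|exact: hQ].
by exists a => //; exact: hQ.
Qed.

Lemma fhs_periodic f A : (forall a, fhs_set A a -> periodic_points f a) ->
  periodic_points (fhs_map f n) A.
Proof.
move=> per; pose Q (x : X) N (K : nat) := iter N f x = x.
have [||N [K0 [N0 hQ]]] := @finite_common_multiple X A Q (fhs_finite A).
- by move=> x N K N' K' NN' _ h; rewrite /Q -(divnK NN') iter_fixed.
- by move=> x /per[N N0 h]; exists N, 0%N.
exists N => //; rewrite iter_fhs_map; apply: fhs_inj; apply/seteqP; split => x /=.
  by move=> [a Aa <-]; rewrite hQ.
by move=> Ax; exists x => //; exact: hQ.
Qed.

(** A power g of f maps the finite set [A] onto itself, so a is the image of some b in [A] under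
    [size s] steps of g. The trajectory of b repeats by then, so a is already on a cycle. *)
Lemma periodic_fhs f A a : periodic_points (fhs_map f n) A -> fhs_set A a ->
  periodic_points f a.
Proof.
move=> [p p0 Ap] Aa; pose g := iter p f.
have gA k : iter k g @` A = A.
  elim: k => [|k IHk]; first by rewrite image_id.
  rewrite -[RHS](congr1 (@fhs_set _ _ _) Ap) iter_fhs_map /= -[in RHS]IHk -image_comp.
  by [].
have /finite_seqP[s As] := fhs_finite A.
have : (iter (size s) g @` A) a by rewrite gA.
move=> [b Ab ba].
have sub : {subset traject g b (size s).+1 <= s}.
  move=> x /trajectP[i _ ->]; suff : [set` s] (iter i g b) by [].
  by rewrite -As -(gA i); exists b.
have : ~~ uniq (traject g b (size s).+1).
  apply/negP => un; have := uniq_leq_size un sub.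
  by rewrite size_traject ltnn.
rewrite looping_uniq negbK => /trajectP[m ms e].
exists ((size s - m) * p)%N; first by rewrite muln_gt0 subn_gt0 ms.
rewrite iterM -/g -ba -iterD.
have -> : (size s - m + size s = (size s - m) + (size s - m) + m)%N by lia.
by rewrite -[in RHS](subnK (ltnW ms)) [in RHS]iterD -e -addnA subnK ?(ltnW ms)// iterD.
Qed.

(** The image of [A] under the pointwise ultrafilter limit [L] is a limit point: convergence along
    the ultrafilter is uniform on the finite set [A]. *)
Lemma fhs_omega_nonempty f A : compact [set: X] ->
  omega_limit (fhs_map f n) A !=set0.
Proof.
move=> cX; have /choice[L hL] (x : X) : exists z : X, (fun k => iter k f x) @ nat_ultra --> z.
  exact: nat_ultra_cvg.
exists (fhs_map L n A); apply/omega_limitP => B /nbhs_ballP[e /= e0 eB] K.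
have e2 : 0 < e / 2 by rewrite divr_gt0.
have UA : nat_ultra (fun k => forall a, fhs_set A a -> ball (L a) (e / 2) (iter k f a)).
  apply: filter_finite; first exact: fhs_finite.
  by move=> a _; exact: (cvg_preimage (hL a) (nbhsx_ballx _ _ e2)).
have [k Kk hk] := nat_ultra_ex K UA; exists k => //; apply: eB.
rewrite iter_fhs_map ballEmdist/=.
apply: (@le_lt_trans _ _ (e / 2)); last by lra.
apply: fhs_dist_le => // [_ [a Aa <-]|_ [a Aa <-]].
  by exists (iter k f a); [exists a|have := hk a Aa; rewrite ballEmdist].
by exists (L a); [exists a|have := hk a Aa; rewrite ballEmdist].
Qed.

End Hyperspace.

(** * Limit, recurrent and periodic points of the induced map *)

Section HyperspaceDynamics.
Context {R : realType} {X : metricType R} (f : X -> X) (n : nat).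
Context (cptX : compact [set: X]) (cX : connected [set: X]).
Context (lcX : locally_connected X) (sepX : separated_points X).
Context (cf : continuous f) (mf : monotone_map f).
Implicit Types A B : finite_hyperspace X n.

Let F := fhs_map f n.

Let F_eap A : eventually_almost_periodic F A.
Proof. by apply: fhs_eap => a _; exact: monotone_eap. Qed.

Lemma fhs_omega_minimal A : minimal_set F (omega_limit F A).
Proof.
by apply: eap_minimal => //; [exact: continuous_fhs_map|exact: fhs_omega_nonempty].
Qed.

Lemma fhs_Lambda_rr : Lambda F = regularly_recurrent F.
Proof.
apply/seteqP; split => [A [B _ BA]|A Arr].
  by apply: eap_regularly_recurrent BA => //; exact: continuous_fhs_map.
by exists A => //; exact: regularly_recurrent_omega.
Qed.

(** Points of a periodic finite set are periodic, so points of a limit [A] of such sets are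
    regularly recurrent. Conversely, late in the orbit of [B] every point is replaced by a periodic
    one close to it, which gives a periodic finite set close to [A]. *)
Lemma fhs_closure_periodic : closure (periodic_points F) = Lambda F.
Proof.
apply/seteqP; split => [A clA|A [B _ /omega_limitP BA]].
  rewrite fhs_Lambda_rr; apply: fhs_regularly_recurrent => a Aa.
  apply: (closure_periodic_rr cptX cX lcX sepX cf mf).
  move=> V /nbhs_ballP[e /= e0 eV].
  have [C [PC]] := clA _ (nbhsx_ballx A _ e0); rewrite ballEmdist/= => /fhs_dist_lt[AC _].
  have [c Cc ac] := AC a Aa; exists c; split; first exact: periodic_fhs PC Cc.
  by apply: eV; rewrite ballEmdist.
move=> V /nbhs_ballP[e /= e0 eV]; have e2 : 0 < e / 2 by rewrite divr_gt0.
have e3 : 0 < e / 3 by rewrite divr_gt0.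
pose Q (x : X) (N K : nat) := forall k, (K <= k)%N ->
  exists2 c, periodic_points f c & mdist c (iter k f x) < e / 3.
have [||N0 [K [_ hQ]]] := @finite_common_multiple X B Q (fhs_finite B).
- by move=> x N K' N' K'' _ KK h k Kk; apply: h; exact: leq_trans Kk.
- move=> x _; have [K hK] := periodic_near cptX cX lcX sepX cf mf x e3.
  by exists 1%N, K.
have [k Kk] := BA _ (nbhsx_ballx A _ e2) K; rewrite ballEmdist/= => Ak.
have /choice[c hc] (x : X) : exists c, fhs_set B x ->
    periodic_points f c /\ mdist c (iter k f x) < e / 3.
  have [Bx|Bx] := pselect (fhs_set B x); last by exists x.
  by have [c cP ck] := hQ x Bx k Kk; exists c.
exists (fhs_map c n B); split.
  by apply: fhs_periodic => _ [b Bb <-]; have [] := hc b Bb.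
apply: eV; rewrite ballEmdist/=.
have := metric_triangle A (iter k F B) (fhs_map c n B).
suff : mdist (iter k F B) (fhs_map c n B) <= e / 3 by lra.
rewrite iter_fhs_map; apply: fhs_dist_le => // [_ [b Bb <-]|_ [b Bb <-]].
  by exists (c b); [exists b|rewrite metric_sym; have [] := hc b Bb].
by exists (iter k f b); [exists b|rewrite metric_sym; have [] := hc b Bb].
Qed.

End HyperspaceDynamics.

Theorem corollary5p4 (R : realType) (X : metricType R) (f : X -> X) (n : nat)
    (dX : dendrite X) (cf : continuous f) (mf : monotone_map f)
    (n_gt0 : (0 < n)%N) :
  (forall A : finite_hyperspace X n,
     minimal_set (fhs_map f n) (omega_limit (fhs_map f n) A)) /\
  (closure (periodic_points (fhs_map f n)) = Lambda (fhs_map f n) /\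
   Lambda (fhs_map f n) = regularly_recurrent (fhs_map f n)).
Proof.
have sepX := dendrite_separated_points dX; have [cptX cX lcX _] := dX.
split; first by move=> A; exact: fhs_omega_minimal.
by split; [exact: fhs_closure_periodic|exact: fhs_Lambda_rr].
Qed.
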